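(* There exists a constant $c>0$ such that the following holds. Let $k=k(N)\ge 2$ be any sequence of integers with $k=o(N^{2/3})$ as $N\to\infty$. Then for every $\varepsilon\in(0,1)$, the $\varepsilon$-mixing time $t_{\mathrm{mix}}(\varepsilon)$ of the $S_k$ shuffle on $N$ cards satisfies $$\frac{6}{\pi^2}\le \liminf_{N\to\infty}\frac{k(k^2-1)\,t_{\mathrm{mix}}(\varepsilon)}{N^2\log N}\le \limsup_{N\to\infty}\frac{k(k^2-1)\,t_{\mathrm{mix}}(\varepsilon)}{N^2\log N}\le c .$$
   Context: $\mathcal S_N$ is the symmetric group on $[N]=\{1,\dots,N\}$; a permutation $\eta\in\mathcal S_N$ is viewed as a deck, $\eta(m)$ being the label of the card at position $m$. For $1\le i<j\le N$, $\eta\in\mathcal S_N$ and $\sigma\in\mathcal S_{j-i+1}$, let $\eta^{\sigma,i,j}\in\mathcal S_N$ be the deck obtained by rearranging the cards in positions $i,\dots,j$ according to $\sigma$: $\eta^{\sigma,i,j}(m)=\eta(m)$ for $m\notin[i,j]$ and $\eta^{\sigma,i,j}(m)=\eta(i-1+\sigma(m-i+1))$ for $m\in[i,j]$. The $S_k$ shuffle on $N$ cards ($2\le k\le N$) is the continuous-time Markov chain $(\eta_t)_{t\ge0}$ on $\mathcal S_N$ in which each block of $k$ consecutive positions $\{i,\dots,i+k-1\}$ ($1\le i\le N-k+1$) carries an independent rate-1 Poisson clock; when it rings, the cards of that block are rearranged by a uniformly random $\sigma\in\mathcal S_k$, i.e. the generator is $(\mathcal Lf)(\eta)=\sum_{i}\frac1{k!}\sum_{\sigma\in\mathcal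 S_k}(f(\eta^{\sigma,i,i+k-1})-f(\eta))$. Its stationary law is the uniform measure $\mu_N$ on $\mathcal S_N$. Total variation distance: $\|\nu-\mu\|_{TV}=\frac12\sum_\eta|\nu(\eta)-\mu(\eta)|$. The $\varepsilon$-mixing time is $t_{\mathrm{mix}}(\varepsilon)=\inf\{t\ge0:\max_{\eta\in\mathcal S_N}\|\mathbb P(\eta_t\in\cdot\mid\eta_0=\eta)-\mu_N\|_{TV}<\varepsilon\}$. *)

(* Defs.v *)
From HB Require Import structures.
From mathcomp Require Import all_boot all_order all_algebra all_fingroup.
From mathcomp Require Import all_classical all_reals all_analysis.
Set Implicit Arguments. Unset Strict Implicit. Unset Printing Implicit Defensive.
Import Order.TTheory GRing.Theory Num.Theory.
Import numFieldNormedType.Exports.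
Local Open Scope classical_set_scope.
Local Open Scope ring_scope.

(* Positions are 0-indexed: 'I_N = {0,...,N-1}; a deck is eta : {perm 'I_N},
   eta m = label of card at position m.  Block starting at position i covers
   positions i, ..., i+k-1 (i = 0, ..., N-k). *)

Definition perm_nat (k : nat) (s : {perm 'I_k}) (j : nat) : nat :=
  if (insub j : option 'I_k) is Some jj then val (s jj) else j.

Definition blk_pos (N k i : nat) (s : {perm 'I_k}) (m : 'I_N) : 'I_N :=
  if ((i <= m) && (m < i + k))%N then insubd m (i + perm_nat s (m - i))%N else m.

Definition is_rearr (N k i : nat) (s : {perm 'I_k}) (eta xi : {perm 'I_N}) : bool :=
  [forall m : 'I_N, xi m == eta (blk_pos i s m)].

(* number of blocks, i.e. total ringing rate *)
Definition nblocks (N k : nat) : nat := (N.+1 - k)%N.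

(* A = L + nblocks * I, i.e. A(eta,xi) = sum_i (1/k!) #{sigma | eta^{sigma,i,i+k-1} = xi} *)
Definition Akernel (R : realType) (N k : nat) (eta xi : {perm 'I_N}) : R :=
  \sum_(0 <= i < nblocks N k)
     (k`!%:R)^-1 * \sum_(s : {perm 'I_k}) (is_rearr i s eta xi)%:R.

Fixpoint Apow (R : realType) (N k : nat) (n : nat) (eta xi : {perm 'I_N}) : R :=
  match n with
  | 0 => (eta == xi)%:R
  | n'.+1 => \sum_(z : {perm 'I_N}) Akernel R k eta z * Apow R k n' z xi
  end.

(* Transition probability P(eta_t = xi | eta_0 = eta) = (exp (t L))(eta,xi)
   = exp(- nblocks t) * sum_n t^n/n! A^n (eta,xi), since L = A - nblocks * I. *)
Definition heat (R : realType) (N k : nat) (t : R) (eta xi : {perm 'I_N}) : R :=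
  expR (- ((nblocks N k)%:R * t)) *
  limn (fun M : nat => \sum_(0 <= n < M) (t ^+ n / n`!%:R * Apow R k n eta xi)).

Definition dTV (R : realType) (N k : nat) (t : R) (eta : {perm 'I_N}) : R :=
  2^-1 * \sum_(xi : {perm 'I_N}) `| heat k t eta xi - (N`!%:R)^-1 |.

(* epsilon-mixing time (extended real; +oo if the set is empty) *)
Definition tmix (R : realType) (N k : nat) (eps : R) : \bar R :=
  ereal_inf [set t%:E | t in [set t : R | 0 <= t /\
                             forall eta : {perm 'I_N}, dTV k t eta < eps]].

Definition mix_ratio (R : realType) (k : nat -> nat) (eps : R) (N : nat) : \bar R :=
  ((k N * ((k N)^2 - 1))%N%:R%:E * tmix N (k N) eps *
   (((N%:R) ^+ 2 * ln (N%:R : R))^-1)%:E)%E.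

(* Main.v *)
(* Both bounds compare the deck with the chain of a single card, whose one-step operator A1 is the
   sum of the block averages.

   Upper bound: if two decks differ by a transposition of the cards at positions p < q, the same
   block rearrangement can be applied to both; once p and q fall in a common block the two decks
   are made equal, and otherwise the order of the two cards is preserved.  Hence the difference
   of the n-step expectations of a [0,1]-valued function is at most |h p - h q|, where h is the
   n-th iterate of A1 on the identity, and this decays exponentially by a Poincare inequality for
   the block averages, with constant of order k^3 / N^2.

   Lower bound: with phi x = cos (pi (x + 1/2) / N), the statistic sum_x phi (eta x) phi x has,
   from the sorted deck, a mean that decays no faster than the Rayleigh quotient of phi, which is
   at most pi^2 k (k^2 - 1) / (12 N^2).  Its variance stays of order N: the variance due to the
   rearrangements telescopes, and the variance due to the choice of blocks is controlled by the
   variances of the evolved profile on single blocks.  The latter are bounded because the profile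
   stays decreasing and antisymmetric with a uniformly small one-sided Laplacian, so that a flux
   argument bounds its oscillation on each block; this is where k^3 <= N^2 is used. *)

Require Import Defs.
From HB Require Import structures.
From mathcomp Require Import all_boot all_order all_algebra all_fingroup.
From mathcomp Require Import all_classical all_reals all_analysis.
From mathcomp Require Import ring lra zify.
Import Order.TTheory GRing.Theory Num.Theory.
Import numFieldNormedType.Exports.
Local Open Scope classical_set_scope.
Local Open Scope ring_scope.

Set Implicit Arguments.
Unset Strict Implicit.
Unset Printing Implicit Defensive.

Lemma nblocks_le N k i : (k <= N)%N -> (i < nblocks N k)%N -> (i + k <= N)%N.
Proof. rewrite /nblocks; lia. Qed.

Lemma nblocks_gt0 N k : (k <= N)%N -> (0 < nblocks N k)%N.
Proof. rewrite /nblocks; lia. Qed.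

(** * Block averages and the one-card operator *)

Section BlockAverages.
Context {R : realType} (N k : nat).
Hypotheses (k_gt0 : (0 < k)%N) (kN : (k <= N)%N).
Implicit Types f g : nat -> R.

Definition bavg i f : R := (\sum_(j < k) f (i + j)%N) / k%:R.
(** For a block inside [[0, N)], the orthogonal projection for [ip N] onto the functions constant on
    block [i]; it is the effect on a one-card function of one uniform rearrangement of that
    block. *)
Definition proj i f x : R := if (i <= x < i + k)%N then bavg i f else f x.
Definition bcov i f g : R :=
  \sum_(j < k) (f (i + j)%N - bavg i f) * (g (i + j)%N - bavg i g).
Definition ip f g : R := \sum_(x < N) f x * g x.
Definition A1 f x : R := \sum_(i < nblocks N k) proj i f x.
Local Notation m := (nblocks N k).

Let k_neq0 : k%:R != 0 :> R.
Proof. by rewrite pnatr_eq0 -lt0n. Qed.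

Lemma sum_supported_block i (d : nat -> R) : (i + k <= N)%N ->
  (forall x, (x < N)%N -> ~~ (i <= x < i + k)%N -> d x = 0) ->
  \sum_(x < N) d x = \sum_(j < k) d (i + j)%N.
Proof.
clear k_gt0 kN k_neq0; move=> ikN d0; rewrite -(big_mkord xpredT d) -(big_mkord xpredT (fun j => d (i + j)%N)).
rewrite (@big_cat_nat _ _ _ i 0 N) //=; last by lia.
rewrite (@big_cat_nat _ _ _ (i + k) i N) //=; last by lia.
rewrite big_nat_cond big1 ?add0r; last by move=> x /andP[] xi _; apply: d0; lia.
rewrite [X in _ + X]big_nat_cond [X in _ + X]big1 ?addr0; last first.
  by move=> x /andP[] xi _; apply: d0; lia.
rewrite -{1}[i]add0n big_addn addKn.
by apply: eq_big_nat => j _; rewrite addnC.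
Qed.

Lemma sum_bavg i f : \sum_(j < k) (f (i + j)%N - bavg i f) = 0.
Proof.
rewrite sumrB sumr_const card_ord -[_ *+ k]mulr_natr /bavg divfK ?subrr //.
Qed.

Lemma bcovEr i f g : bcov i f g = \sum_(j < k) (f (i + j)%N - bavg i f) * g (i + j)%N.
Proof.
rewrite /bcov; under eq_bigr do rewrite mulrBr.
by rewrite sumrB -mulr_suml sum_bavg mul0r subr0.
Qed.

Lemma bcovC i f g : bcov i f g = bcov i g f.
Proof. by apply: eq_bigr => j _; rewrite mulrC. Qed.

Lemma bcov_ge0 i f : 0 <= bcov i f f.
Proof. by apply: sumr_ge0 => j _; rewrite -expr2 sqr_ge0. Qed.

Lemma proj_in i f (j : 'I_k) : proj i f (i + j) = bavg i f.
Proof. by rewrite /proj leq_addr ltn_add2l ltn_ord. Qed.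

Lemma bavg_proj i f : bavg i (proj i f) = bavg i f.
Proof.
rewrite {1}/bavg; under eq_bigr do rewrite proj_in.
by rewrite sumr_const card_ord -[_ *+ k]mulr_natr mulfK.
Qed.

Lemma bcov_projr i f g : bcov i f (proj i g) = 0.
Proof.
apply: big1 => j _; by rewrite bavg_proj proj_in subrr mulr0.
Qed.

Lemma ip_sym f g : ip f g = ip g f.
Proof. by apply: eq_bigr => x _; rewrite mulrC. Qed.

(** [f] and [proj i f] differ only on block [i], by the deviation of [f] from its average, and
    pairing this deviation with [g] gives the covariance. *)
Lemma ip_projl i f g : (i + k <= N)%N -> ip (proj i f) g = ip f g - bcov i f g.
Proof.
move=> ikN; apply/eqP; rewrite eq_sym subr_eq addrC -subr_eq /ip -sumrB; apply/eqP.
rewrite (@sum_supported_block i (fun x => f x * g x - proj i f x * g x)) //.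
  by rewrite bcovEr; apply: eq_bigr => j _; rewrite proj_in mulrBl.
by move=> x _ /negbTE xi; rewrite /proj xi subrr.
Qed.

Lemma ip_proj i f g : (i + k <= N)%N -> ip (proj i f) (proj i g) = ip f g - bcov i f g.
Proof.
by move=> ikN; rewrite ip_projl // bcov_projr subr0 ip_sym ip_projl // ip_sym bcovC.
Qed.

Lemma ip_projr i f g : (i + k <= N)%N -> ip f (proj i g) = ip (proj i f) g.
Proof. by move=> ikN; rewrite ip_sym !ip_projl // bcovC ip_sym. Qed.

Lemma ip_ge0 f : 0 <= ip f f.
Proof. by apply: sumr_ge0 => j _; rewrite -expr2 sqr_ge0. Qed.

Lemma ip_A1l f g : ip (A1 f) g = \sum_(i < m) ip (proj i f) g.
Proof.
rewrite /ip exchange_big /=; apply: eq_bigr => x _.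
by rewrite /A1 mulr_suml.
Qed.

(** Summing [ip_projl] over the blocks identifies the Dirichlet form of [m - A1]. The spectral gap
    and the Rayleigh quotient of the cosine are both estimates of this sum of covariances. *)
Lemma ip_A1E f g : ip (A1 f) g = m%:R * ip f g - \sum_(i < m) bcov i f g.
Proof.
rewrite ip_A1l (eq_bigr (fun i : 'I_m => ip f g - bcov i f g)); last first.
  by move=> i _; rewrite ip_projl // (nblocks_le kN).
by rewrite sumrB sumr_const card_ord mulr_natl.
Qed.

Lemma ip_A1C f g : ip (A1 f) g = ip f (A1 g).
Proof.
rewrite ip_sym [in LHS]ip_sym [in RHS]ip_sym !ip_A1E ip_sym.
by congr (_ - _); apply: eq_bigr => i _; rewrite bcovC.
Qed.

Lemma ip_A1_ge0 f : 0 <= ip f (A1 f).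
Proof.
rewrite ip_sym ip_A1l sumr_ge0 // => i _.
have ikN := nblocks_le kN (ltn_ord i).
by rewrite ip_projl // -ip_proj // ip_ge0.
Qed.

Lemma ipDl a f b g h :
  ip (fun x => a * f x + b * g x) h = a * ip f h + b * ip g h.
Proof.
by rewrite /ip !mulr_sumr -big_split /=; apply: eq_bigr => x _; ring.
Qed.

Lemma ipDr a f b g h :
  ip h (fun x => a * f x + b * g x) = a * ip h f + b * ip h g.
Proof. by rewrite ip_sym ipDl ![ip h _]ip_sym. Qed.

Lemma bavg_lin i a f b g :
  bavg i (fun x => a * f x + b * g x) = a * bavg i f + b * bavg i g.
Proof.
by rewrite /bavg big_split /= -!mulr_sumr mulrDl !mulrA.
Qed.

Lemma proj_lin i a f b g :
  proj i (fun x => a * f x + b * g x) = (fun x => a * proj i f x + b * proj i g x).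
Proof.
by apply/funext => x; rewrite /proj; case: ifP => // _; rewrite bavg_lin.
Qed.

Lemma A1_lin a f b g :
  A1 (fun x => a * f x + b * g x) = (fun x => a * A1 f x + b * A1 g x).
Proof.
apply/funext => x; rewrite /A1 !mulr_sumr -big_split /=.
by apply: eq_bigr => i _; rewrite proj_lin.
Qed.

Lemma bavg_cst i (c : R) : bavg i (fun=> c) = c.
Proof. by rewrite /bavg sumr_const card_ord -[_ *+ k]mulr_natr mulfK. Qed.

Lemma proj_cst i (c : R) : proj i (fun=> c) = (fun=> c).
Proof. by apply/funext => x; rewrite /proj bavg_cst if_same. Qed.

Lemma A1_cst (c : R) : A1 (fun=> c) = (fun=> m%:R * c).
Proof.
apply/funext => x; rewrite /A1; under eq_bigr do rewrite proj_cst.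
by rewrite sumr_const card_ord mulr_natl.
Qed.

Lemma bavg_le i f (c : R) : (forall j, (j < k)%N -> f (i + j)%N <= c) -> bavg i f <= c.
Proof.
move=> fc; rewrite ler_pdivrMr ?ltr0n // mulr_natr -[X in _ *+ X](card_ord k) -sumr_const.
by apply: ler_sum => j _; apply: fc.
Qed.

Lemma bavg_ge i f (c : R) : (forall j, (j < k)%N -> c <= f (i + j)%N) -> c <= bavg i f.
Proof.
move=> fc; rewrite ler_pdivlMr ?ltr0n // mulr_natr -[X in _ *+ X](card_ord k) -sumr_const.
by apply: ler_sum => j _; apply: fc.
Qed.

Lemma proj_le_sup i f (c : R) : (i + k <= N)%N ->
  (forall x, (x < N)%N -> f x <= c) -> forall x, (x < N)%N -> proj i f x <= c.
Proof.
move=> ikN fc x xN; rewrite /proj; case: ifP => _; last exact: fc.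
by apply: bavg_le => j jk; apply: fc; lia.
Qed.

Lemma A1_le_sup f (c : R) :
  (forall x, (x < N)%N -> f x <= c) -> forall x, (x < N)%N -> A1 f x <= m%:R * c.
Proof.
move=> fc x xN; rewrite mulr_natl -[X in _ *+ X](card_ord m) -sumr_const.
by apply: ler_sum => i _; apply: proj_le_sup => //; apply: nblocks_le.
Qed.

Definition decr f := forall x y, (x <= y < N)%N -> f y <= f x.

(** The average of a decreasing function over a block lies between its values to the left and to the
    right of the block. *)
Lemma decr_proj i f : (i + k <= N)%N -> decr f -> decr (proj i f).
Proof.
move=> ikN df x y /andP[xy yN]; rewrite /proj.
case: ifP => yi; case: ifP => xi //; last by apply: df; lia.
- by apply: bavg_le => j jk; apply: df; lia.
- by apply: bavg_ge => j jk; apply: df; lia.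
Qed.

Lemma decr_A1 f : decr f -> decr (A1 f).
Proof.
move=> df x y xy; apply: ler_sum => i _.
by apply: decr_proj => //; apply: nblocks_le.
Qed.

Lemma decr_iterA1 n f : decr f -> decr (iter n A1 f).
Proof. by move=> df; elim: n => //= n; apply: decr_A1. Qed.

Lemma iterA1_le_sup n f (c : R) : (forall x, (x < N)%N -> f x <= c) ->
  forall x, (x < N)%N -> iter n A1 f x <= m%:R ^+ n * c.
Proof.
move=> fc; elim: n => [|n IH] x xN /=; first by rewrite mul1r; apply: fc.
by rewrite exprS -mulrA; apply: A1_le_sup.
Qed.

Lemma iterA1_lin n a f b g : iter n A1 (fun x => a * f x + b * g x) =
  (fun x => a * iter n A1 f x + b * iter n A1 g x).
Proof. by elim: n => //= n ->; rewrite A1_lin. Qed.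

(** Self-adjointness moves one factor [A1] to the left, which lowers [n] by two; the base cases are
    the positivity of [ip] and of [A1]. *)
Lemma ip_iterA1_ge0 n f : 0 <= ip f (iter n A1 f).
Proof.
elim/ltn_ind: n f => -[|[|n]] IH f; [exact: ip_ge0 | exact: ip_A1_ge0 |].
by rewrite /= -ip_A1C -iterS iterSr; apply: IH; lia.
Qed.

(** Positivity of [A1] at [A1 f - rho f] gives [2 rho |A1 f|^2 <= ip (A1 f) (A1 (A1 f)) + rho^2 ip f
    (A1 f)]; the two Rayleigh bounds then leave [rho |A1 f|^2 <= rho^3 |f|^2]. This takes the place
    of a diagonalisation. *)
Lemma ip_A1_contract f (rho : R) : 0 < rho ->
  ip f (A1 f) <= rho * ip f f -> ip (A1 f) (A1 (A1 f)) <= rho * ip (A1 f) (A1 f) ->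
  ip (A1 f) (A1 f) <= rho ^+ 2 * ip f f.
Proof.
move=> rho0 h1 h2.
have := ip_A1_ge0 (fun x => 1 * A1 f x + (- rho) * f x).
rewrite A1_lin !ipDl !ipDr -[ip f (A1 (A1 f))]ip_A1C.
set a := ip (A1 f) (A1 f) in h2 *; set b := ip f (A1 f) in h1 *; set c := ip f f in h1 *.
set d := ip (A1 f) _ in h2 * => h.
have : rho * a <= rho * (rho ^+ 2 * c) by nra.
by rewrite ler_pM2l.
Qed.

(* [ip f (A1 ^ n (A1 - rho) ^ 2 f)] is nonnegative, so [ip f (A1 ^ n (A1 - rho) f)] stays nonnegative. *)
Lemma ip_iterA1_lower f (rho : R) n : 0 <= rho -> rho * ip f f <= ip f (A1 f) ->
  rho ^+ n * ip f f <= ip f (iter n A1 f).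
Proof.
move=> rho0 h0.
have step p : rho * ip f (iter p A1 f) <= ip f (iter p.+1 A1 f).
  elim: p => [//|p IH].
  have := ip_iterA1_ge0 p (fun x => 1 * A1 f x + (- rho) * f x).
  rewrite iterA1_lin !ipDl !ipDr -iterSr ip_A1C -iterS.
  rewrite ip_A1C -iterS.
  set a := ip f _ in IH *; set b := ip f _ in IH *; set c := ip f _ in IH *.
  move=> h; have : rho * (rho * a) <= rho * b by apply: ler_wpM2l.
  by move: IH h; rewrite /a /b /c; nra.
elim: n => [|n IH]; first by rewrite mul1r.
apply: le_trans (step n); rewrite exprS -mulrA; exact: ler_wpM2l.
Qed.

End BlockAverages.

(** * A Poincare inequality for block averages *)

Section SpectralGap.
Context {R : realType}.
Implicit Types (f g : nat -> R) (k r n : nat).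

Lemma sum_shift_le g d n K : (forall j, 0 <= g j) -> (d + n <= K)%N ->
  \sum_(t < n) g (d + t)%N <= \sum_(j < K) g j.
Proof.
move=> g0 dnK; rewrite -(big_mkord xpredT g) -(big_mkord xpredT (fun t => g (d + t)%N)).
rewrite (@big_cat_nat _ _ _ d 0 K) //=; last by lia.
rewrite (@big_cat_nat _ _ _ (d + n) d K) //=; last by lia.
have -> : \sum_(d <= i < d + n) g i = \sum_(0 <= t < n) g (d + t)%N.
  by rewrite -{1}[d]add0n big_addn addKn; apply: eq_bigr => j _; rewrite addnC.
rewrite ler_wpDl ?sumr_ge0 // ler_wpDr ?sumr_ge0 //.
Qed.

(** The cross term vanishes because deviations from the block average sum to zero. *)
Lemma sum_sqr_sub k i f y : (0 < k)%N -> \sum_(j < k) (y - f (i + j)%N) ^+ 2 =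
  k%:R * (y - bavg k i f) ^+ 2 + bcov k i f f.
Proof.
move=> k0; have := sum_bavg k0 i f; rewrite /bcov; set a := bavg k i f => sa0.
have -> : \sum_(j < k) (y - f (i + j)%N) ^+ 2 = \sum_(j < k) ((y - a) ^+ 2
    + (f (i + j)%N - a) * (f (i + j)%N - a) - 2 * (y - a) * (f (i + j)%N - a)).
  by apply: eq_bigr => j _; ring.
have e : \sum_(j < k) 2 * (y - a) * (f (i + j)%N - a) = 0.
  by rewrite -mulr_sumr sa0 mulr0.
rewrite sumrB big_split /= e subr0.
by rewrite sumr_const card_ord mulr_natl.
Qed.

Lemma sqr_sub_bavg_le k i f y : (0 < k)%N ->
  k%:R * (y - bavg k i f) ^+ 2 <= \sum_(j < k) (y - f (i + j)%N) ^+ 2.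
Proof. by move=> k0; rewrite sum_sqr_sub // lerDl bcov_ge0. Qed.

Lemma bcov_le k i f y : (0 < k)%N ->
  bcov k i f f <= \sum_(j < k) (y - f (i + j)%N) ^+ 2.
Proof. by move=> k0; rewrite sum_sqr_sub // lerDr mulr_ge0 ?sqr_ge0. Qed.

Lemma sqr_sum_le n f : (\sum_(j < n) f j) ^+ 2 <= n%:R * \sum_(j < n) f j ^+ 2.
Proof.
case: n => [|n]; first by rewrite !big_ord0 expr0n /= mul0r.
have := sqr_sub_bavg_le 0 f 0 (ltn0Sn n).
under [X in _ <= X]eq_bigr do rewrite sub0r sqrrN add0n.
rewrite sub0r sqrrN /bavg expr_div_n.
have n0 : n.+1%:R != 0 :> R by rewrite pnatr_eq0.
move=> h; have := ler_wpM2l (ler0n R n.+1) h.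
congr (_ <= _); rewrite mulrA.
have -> : \sum_(j < n.+1) f (0 + j)%N = \sum_(j < n.+1) f j by [].
by field.
Qed.

(* Points in the overlap of the two blocks are compared with both averages. *)
Lemma bavg_dist k r i j f : (r < k)%N -> (i <= j <= i + r)%N ->
  (k - r)%N%:R * (bavg k i f - bavg k j f) ^+ 2 <= 2 * (bcov k i f f + bcov k j f f).
Proof.
move=> rk /andP[ij jir].
set a := bavg k i f; set b := bavg k j f.
have -> : (k - r)%N%:R * (a - b) ^+ 2 = \sum_(t < k - r) (a - b) ^+ 2.
  by rewrite sumr_const card_ord mulr_natl.
apply: (@le_trans _ _ (\sum_(t < k - r) (2 * (f (i + (j - i + t))%N - a) ^+ 2
   + 2 * (f (j + (0 + t))%N - b) ^+ 2))).
  apply: ler_sum => t _; have -> : (i + (j - i + t) = j + (0 + t))%N by lia.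
  set y := f _; have := sqr_ge0 (2 * y - a - b); nra.
rewrite big_split /= -!mulr_sumr -mulrDr ler_pM2l // /bcov.
apply: lerD.
  apply: (le_trans (@sum_shift_le (fun t => (f (i + t)%N - a) ^+ 2) (j - i) (k - r) k _ _)).
  - by move=> ?; apply: sqr_ge0.
  - lia.
  - by apply: ler_sum => t _; rewrite expr2.
apply: (le_trans (@sum_shift_le (fun t => (f (j + t)%N - b) ^+ 2) 0 (k - r) k _ _)).
- by move=> ?; apply: sqr_ge0.
- lia.
- by apply: ler_sum => t _; rewrite expr2.
Qed.

(** The clamped index [minn x M] takes each value below [M] once and the value [M] exactly [n - M]
    times. *)
Lemma sum_minn_le g M s K n : (forall j, 0 <= g j) -> (M < n)%N -> (M + s < K)%N ->
  \sum_(x < n) g (minn x M + s)%N <= (n - M)%N%:R * \sum_(j < K) g j.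
Proof.
move=> g0 Mn MsK; have -> : n = (M + (n - M))%N by lia.
rewrite addKn big_split_ord /=.
have -> : \sum_(i < n - M) g (minn (M + i) M + s)%N = (n - M)%N%:R * g (M + s)%N.
  under eq_bigr do rewrite (minn_idPr (leq_addr _ _)).
  by rewrite sumr_const card_ord mulr_natl.
have : \sum_(x < M.+1) g (s + x)%N <= \sum_(j < K) g j by apply: sum_shift_le => //; lia.
rewrite big_ord_recr /= [(s + M)%N]addnC => h.
have -> : \sum_(i < M) g (minn i M + s)%N = \sum_(i < M) g (s + i)%N.
  by apply: eq_bigr => i _; congr g; have := ltn_ord i; lia.
apply: le_trans (ler_wpM2l (ler0n R _) h); rewrite mulrDr lerD2r.
rewrite ler_peMl ?sumr_ge0 // ler1n; lia.
Qed.

Context (N k : nat) (k2 : (2 <= k)%N) (kN : (2 * k <= N)%N).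
Local Notation m := (nblocks N k).
(* [c] smooths the block averages [a] over [r] consecutive blocks: its increments
   [(a (i + r) - a i) / r] involve blocks that still overlap in about [k / 2] points. *)
Let r := uphalf k.
Let a f i := bavg k i f.
Let c f i := bavg r i (a f).
Let V f i := bcov k i f f.
Let Z f := \sum_(i < m) V f i.

Let V_ge0 f i : 0 <= V f i. Proof. exact: bcov_ge0. Qed.
Let r_gt0 : (0 < r)%N. Proof. rewrite /r; lia. Qed.
Let rk : (r < k)%N. Proof. rewrite /r; lia. Qed.
Let rm : (r <= m)%N. Proof. rewrite /r /nblocks; lia. Qed.

Let cS f i : c f i.+1 - c f i = (a f (i + r)%N - a f i) / r%:R.
Proof.
rewrite /c /bavg -mulrBl; congr (_ / _).
have -> : \sum_(j < r) a f (i.+1 + j)%N = \sum_(j < r) a f (i + j.+1)%N.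
  by apply: eq_bigr => j _; rewrite addSnnS.
have : \sum_(j < r.+1) a f (i + j)%N = a f (i + 0)%N + \sum_(j < r) a f (i + j.+1)%N.
  by rewrite big_ord_recl; congr (_ + _); apply: eq_bigr => j _; rewrite /= add1n.
by rewrite big_ord_recr /= addn0 => h; lra.
Qed.

(** Cauchy-Schwarz along the path from [0] to [i] costs a factor [i <= N]. Each increment of [c] is
    handled by [bavg_dist] for the blocks [j] and [j + r], and every block variance is used at most
    twice. *)
Let c_dist f i : (i <= m - r)%N ->
  (r%:R ^+ 2 * (k - r)%N%:R) * (c f i - c f 0) ^+ 2 <= N%:R * (4 * Z f).
Proof.
move=> imr; have r0 : r%:R != 0 :> R by rewrite pnatr_eq0 -lt0n.
have -> : c f i - c f 0 = \sum_(j < i) (c f j.+1 - c f j).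
  by rewrite -(big_mkord xpredT (fun j => c f j.+1 - c f j)) telescope_sumr.
apply: (@le_trans _ _ ((r%:R ^+ 2 * (k - r)%N%:R) *
   (i%:R * \sum_(j < i) (c f j.+1 - c f j) ^+ 2))).
  by rewrite ler_wpM2l ?mulr_ge0 ?ler0n ?sqr_ge0 // (sqr_sum_le i (fun j => c f j.+1 - c f j)).
rewrite mulrCA; apply: (@le_trans _ _ (i%:R * (4 * Z f))); last first.
  by rewrite ler_wpM2r ?mulr_ge0 ?sumr_ge0 // ler_nat; move: imr; rewrite /nblocks; lia.
rewrite ler_wpM2l ?ler0n // mulr_sumr.
apply: (@le_trans _ _ (\sum_(j < i) (2 * (V f j + V f (r + j)%N)))).
  apply: ler_sum => j _; rewrite cS expr_div_n.
  have -> : r%:R ^+ 2 * (k - r)%N%:R * ((a f (j + r)%N - a f j) ^+ 2 / r%:R ^+ 2)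
     = (k - r)%N%:R * (a f j - a f (r + j)%N) ^+ 2 :> R by rewrite addnC; field.
  by apply: bavg_dist => //; lia.
rewrite -mulr_sumr big_split /=.
have : \sum_(j < i) V f (r + j)%N <= Z f by apply: sum_shift_le => //; lia.
have : \sum_(j < i) V f j <= Z f by apply: (@sum_shift_le (V f) 0) => //; lia.
by lra.
Qed.

(** A point [x < m - 1] is charged to the first entry of block [x], and the remaining [k] points to
    the last block. *)
Let block_dev f : \sum_(x < N) (f x - a f (minn x m.-1)) ^+ 2 <= Z f.
Proof.
pose M := m.-1.
have eN : N = (M + k)%N by rewrite /M /nblocks; lia.
have em : m = M.+1 by rewrite /M /nblocks; lia.
rewrite /Z -/M em eN big_split_ord /= big_ord_recr /=.
apply: lerD.
  apply: ler_sum => i _; have -> : minn i M = i by have := ltn_ord i; lia.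
  rewrite /V /bcov (bigD1 (Ordinal (ltnW k2))) //= addn0 expr2 ler_wpDr //.
  by apply: sumr_ge0 => j _; rewrite -expr2 sqr_ge0.
apply: ler_sum => i _; have -> : minn (M + i) M = M by lia.
by rewrite expr2.
Qed.

(** Convexity replaces [c] by the [r] averages it is made of, each at distance at most [r] from the
    block of [x]. Clamping repeats the last index at most [k] times for [a] and [2 * k] times for
    [c], whence [6 = 2 * (1 + 2)]. *)
Let block_avg_dev f : (k - r)%N%:R *
  \sum_(x < N) (a f (minn x m.-1) - c f (minn x (m - r))) ^+ 2 <= 6 * k%:R * Z f.
Proof.
have rr0 : 0 < r%:R :> R by rewrite ltr0n.
set B := 6 * _ * _; rewrite -(ler_pM2l rr0) !mulr_sumr.
apply: (@le_trans _ _ (\sum_(x < N) \sum_(s < r)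
   2 * (V f (minn x m.-1 + 0)%N + V f (minn x (m - r) + s)%N))).
  apply: ler_sum => x _; rewrite mulrCA.
  have kr0 : 0 <= (k - r)%N%:R :> R by rewrite ler0n.
  apply: (le_trans (ler_wpM2l kr0 (sqr_sub_bavg_le _ _ _ r_gt0))).
  rewrite mulr_sumr; apply: ler_sum => s _; rewrite addn0.
  have sr := ltn_ord s; have xN := ltn_ord x.
  have [h|h] := leqP (minn x m.-1) (minn x (m - r) + s).
    by apply: bavg_dist => //; move: rm h; lia.
  rewrite -sqrrN opprB [X in _ <= 2 * X]addrC.
  by apply: bavg_dist => //; move: rm h; lia.
rewrite exchange_big /=.
apply: (@le_trans _ _ (\sum_(s < r) 2 * (k%:R * Z f + 2 * k%:R * Z f))).
  apply: ler_sum => s _; rewrite -mulr_sumr ler_pM2l // big_split /=.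
  have sr := ltn_ord s; apply: lerD.
    have e : (N - m.-1)%N = k by rewrite /nblocks; lia.
    apply: (@le_trans _ _ ((N - m.-1)%N%:R * Z f)); last by rewrite e.
    by apply: sum_minn_le => //; rewrite /nblocks; lia.
  apply: (@le_trans _ _ ((N - (m - r))%N%:R * Z f)).
    by apply: sum_minn_le => //; move: rm; rewrite /nblocks; lia.
  rewrite ler_wpM2r ?sumr_ge0 // -natrM ler_nat; move: rk rm; rewrite /nblocks; lia.
rewrite sumr_const card_ord -[_ *+ r]mulr_natl /B; lra.
Qed.

(** The deviation [f x - c0] is split through the block average and the smoothed average. The three
    parts cost [1], [18] and [48 N^2 / k^3] times [Z f]; [k^3 <= N^2] absorbs the first two, and
    [201 = 3 * (1 + 18 + 48)]. *)
Lemma spectral_gap f : (k ^ 3 <= N ^ 2)%N -> \sum_(x < N) f x = 0 ->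
  k%:R ^+ 3 * ip N f f <= 201 * N%:R ^+ 2 * \sum_(i < m) bcov k i f f.
Proof.
move=> k3N f0; set c0 := c f 0.
have h1 : ip N f f <= \sum_(x < N) (f x - c0) ^+ 2.
  have -> : \sum_(x < N) (f x - c0) ^+ 2 =
     \sum_(x < N) (f x * f x + c0 ^+ 2 - 2 * c0 * f x) by apply: eq_bigr => x _; ring.
  have e : \sum_(x < N) 2 * c0 * f x = 0 by rewrite -mulr_sumr f0 mulr0.
  rewrite sumrB big_split /= e subr0 lerDl.
  by apply: sumr_ge0 => *; apply: sqr_ge0.
have h2 : \sum_(x < N) (f x - c0) ^+ 2 <= 3 * \sum_(x < N) (f x - a f (minn x m.-1)) ^+ 2
    + 3 * \sum_(x < N) (a f (minn x m.-1) - c f (minn x (m - r))) ^+ 2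
    + 3 * \sum_(x < N) (c f (minn x (m - r)) - c0) ^+ 2.
  rewrite -!mulrDr -!big_split /= mulr_sumr; apply: ler_sum => x _.
  set p := a _ _; set q := c _ _.
  have := sqr_ge0 (f x - p - (p - q)); have := sqr_ge0 (f x - p - (q - c0)).
  have := sqr_ge0 (p - q - (q - c0)).
  have -> : f x - c0 = (f x - p) + (p - q) + (q - c0) by ring.
  by nra.
have h3 : (r%:R ^+ 2 * (k - r)%N%:R) * \sum_(x < N) (c f (minn x (m - r)) - c0) ^+ 2
    <= N%:R * (N%:R * (4 * Z f)).
  rewrite mulr_sumr; apply: (@le_trans _ _ (\sum_(x < N) N%:R * (4 * Z f))); last first.
    by rewrite sumr_const card_ord -[_ *+ N]mulr_natl.
  by apply: ler_sum => x _; apply: c_dist; lia.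
have := block_dev f; have := block_avg_dev f.
move: h1 h2 h3; set T0 := \sum_(x < N) _; set T1 := \sum_(x < N) _.
set T2 := \sum_(x < N) _; set T3 := \sum_(x < N) _; rewrite -/(Z f).
have Z0 : 0 <= Z f by apply: sumr_ge0.
have T30 : 0 <= T3 by apply: sumr_ge0 => *; apply: sqr_ge0.
have T20 : 0 <= T2 by apply: sumr_ge0 => *; apply: sqr_ge0.
(* [r] and [k - r] are [k / 2] rounded up and down; the factor [3] in the second bound is attained
   at [k = 3]. *)
have kr : k%:R <= 2 * r%:R :> R by rewrite -natrM ler_nat /r; lia.
have kkr : k%:R <= 3 * (k - r)%N%:R :> R by rewrite -natrM ler_nat /r; lia.
have k3N' : k%:R ^+ 3 <= N%:R ^+ 2 :> R by rewrite -!natrX ler_nat.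
have K0 : 0 < k%:R :> R by rewrite ltr0n; lia.
move: (k%:R : R) (r%:R : R) ((k - r)%N%:R : R) (N%:R : R) (Z f) (ip N f f) T0 T1 T2 T3
  Z0 T20 T30 kr kkr k3N' K0 => K r' q n z I T0' T1' T2' T3'
  Z0 T20 T30 kr kkr k3N' K0 h1 h2 h3 h4 h5.
have e2 : T2' <= 18 * z.
  rewrite -(ler_pM2l K0).
  have : K * T2' <= 3 * q * T2' by rewrite ler_wpM2r.
  lra.
have e3 : K ^+ 3 * T3' <= 48 * n ^+ 2 * z.
  have : K ^+ 2 <= (2 * r') ^+ 2 by rewrite ler_sqr ?nnegrE; lra.
  move=> hh; have hK : K ^+ 3 <= (2 * r') ^+ 2 * (3 * q).
    by rewrite exprSr; apply: ler_pM => //; rewrite ?sqr_ge0 // ltW.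
  by apply: (le_trans (ler_wpM2r T30 hK)); lra.
have K30 : 0 <= K ^+ 3 by rewrite exprn_ge0 // ltW.
have g1 : K ^+ 3 * I <= K ^+ 3 * (3 * z + 3 * (18 * z) + 3 * T3').
  by apply: ler_wpM2l => //; lra.
have g2 : K ^+ 3 * z <= n ^+ 2 * z by apply: ler_wpM2r.
by apply: (le_trans g1); lra.
Qed.

End SpectralGap.

(** * Oscillation of decreasing profiles with small one-sided Laplacian *)

Section Regularity.
Context {R : realType}.
Implicit Types (f g : nat -> R).

Lemma sum_inv_sqr_le n : \sum_(x < n) ((x.+1%:R : R) ^+ 2)^-1 <= 2.
Proof.
(* The induction runs on a sharper bound, whose increments [2 / (y (y + 1))] dominate [1 / y^2] for
   [y >= 1]. *)
suff : \sum_(x < n) ((x.+1%:R : R) ^+ 2)^-1 <= 2 - 2 / n.+1%:R.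
  by move=> h; apply: (le_trans h); rewrite lerBlDr lerDl divr_ge0.
elim: n => [|n IH]; first by rewrite big_ord0 divr1 subrr.
rewrite big_ord_recr /=.
have n1 : 1 <= n.+1%:R :> R by rewrite ler1n.
have -> : n.+2%:R = n.+1%:R + 1 :> R by rewrite -[n.+2]addn1 natrD.
move: (n.+1%:R) n1 IH => /= y y1 IH.
have e : 2 / y - 2 / (y + 1) - (y ^+ 2)^-1 = (y - 1) / (y ^+ 2 * (y + 1)).
  by field; apply/andP; split; apply: lt0r_neq0; lra.
have : 0 <= (y - 1) / (y ^+ 2 * (y + 1)).
  by rewrite divr_ge0 ?mulr_ge0 ?sqr_ge0 //; lra.
by rewrite -e; lra.
Qed.

(* For [q = k] this says that the partial sums of a decreasing sequence centred on its average
   are nonnegative. *)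
Lemma centred_partial_sum_ge k i p q f (alpha beta : R) : (0 < k)%N -> (p <= q <= k)%N ->
  (forall t, (t < p)%N -> alpha <= f (i + t)%N) ->
  (forall t, (p <= t < q)%N -> f (i + t)%N <= alpha) ->
  (forall t, (q <= t < k)%N -> f (i + t)%N <= beta) ->
  p%:R * (k - q)%N%:R * (alpha - beta) <=
    k%:R * \sum_(t < p) (f (i + t)%N - bavg k i f).
Proof.
move=> k0 /andP[pq qk] h1 h2 h3; pose g t := f (i + t)%N.
have k0' : k%:R != 0 :> R by rewrite pnatr_eq0 -lt0n.
have eavg : k%:R * bavg k i f = \sum_(0 <= t < p) g t + \sum_(p <= t < q) g t
    + \sum_(q <= t < k) g t.
  rewrite /bavg mulrC divfK // -(big_mkord xpredT g).
  rewrite (@big_cat_nat _ _ _ p 0 k) //=; last by lia.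
  by rewrite (@big_cat_nat _ _ _ q p k) ?addrA.
have e : k%:R * \sum_(t < p) (f (i + t)%N - bavg k i f) =
   k%:R * \sum_(0 <= t < p) g t - p%:R * (k%:R * bavg k i f).
  by rewrite sumrB sumr_const card_ord -[_ *+ p]mulr_natl -(big_mkord xpredT g); ring.
have b1 : p%:R * alpha <= \sum_(0 <= t < p) g t.
  rewrite mulr_natl -[X in _ *+ X]subn0 -sumr_const_nat big_nat [X in _ <= X]big_nat.
  by apply: ler_sum => t /andP[_ tp]; apply: h1.
have b2 : \sum_(p <= t < q) g t <= (q - p)%N%:R * alpha.
  rewrite mulr_natl -sumr_const_nat big_nat [X in _ <= X]big_nat.
  by apply: ler_sum => t tp; apply: h2.
have b3 : \sum_(q <= t < k) g t <= (k - q)%N%:R * beta.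
  rewrite mulr_natl -sumr_const_nat big_nat [X in _ <= X]big_nat.
  by apply: ler_sum => t tp; apply: h3.
rewrite e eavg.
move: (\sum_(0 <= t < p) _) (\sum_(p <= t < q) _) (\sum_(q <= t < k) _) b1 b2 b3 => X Y W b1 b2 b3.
have P0 : 0 <= p%:R :> R by [].
have c2 := ler_wpM2l P0 b2; have c3 := ler_wpM2l P0 b3.
have kp : 0 <= (k - p)%N%:R :> R by [].
have c1 := ler_wpM2l kp b1.
have -> : k%:R = (k - p)%N%:R + p%:R :> R by rewrite -natrD subnK //; lia.
move: c1 c2; have -> : (k - p)%N%:R = (k - q)%N%:R + (q - p)%N%:R :> R.
  by rewrite -natrD; congr (_%:R); lia.
nra.
Qed.

Lemma sum_rev_ge n : n%:R ^+ 2 / 2 <= \sum_(t < n) (n - t)%N%:R :> R.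
Proof.
elim: n => [|n IH]; first by rewrite big_ord0 expr0n /= mul0r.
rewrite big_ord_recl /= subn0; under eq_bigr do rewrite /= /bump ?add1n ?subSS.
apply: (le_trans _ (lerD (lexx _) IH)).
by rewrite -[n.+1]addn1 natrD; nra.
Qed.

Context (N k : nat) (k2 : (2 <= k)%N) (kN : (k <= N)%N).
Local Notation m := (nblocks N k).

(* Summing [m f - A1 f] over [x <= a] leaves only the blocks that straddle [a], each
   contributing a nonnegative amount; those that contain both [a] and [a + h] near their
   middle give the bound. *)
Lemma flux_bound f (eps : R) a h : decr N f -> (1 <= h)%N -> (4 * h <= k + 2)%N ->
  (a < m)%N -> (a + h < N)%N ->
  (forall x, (x < N)%N -> m%:R * f x - A1 N k f x <= eps) ->
  (f a - f (a + h)%N) * (minn h a.+1)%:R ^+ 2 <= 4 * (a.+1%:R * eps).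
Proof.
move=> df h1 h4 am ahN hL; have k0 : (0 < k)%N by lia.
have k0R : 0 < k%:R :> R by rewrite ltr0n.
pose Phi i := \sum_(x < a.+1) (f x - proj k i f x).
have flux : \sum_(i < m) Phi i <= a.+1%:R * eps.
  rewrite /Phi exchange_big /= mulr_natl -[X in _ *+ X](card_ord a.+1) -sumr_const.
  apply: ler_sum => x _; rewrite sumrB sumr_const card_ord -[_ *+ m]mulr_natl.
  by apply: hL; move: (ltn_ord x) am; rewrite /nblocks; lia.
have PhiE i : (i <= a)%N ->
    Phi i = \sum_(t < minn (a.+1 - i) k) (f (i + t)%N - bavg k i f).
  move=> ia; rewrite /Phi.
  rewrite (@sum_supported_block R a.+1 (minn (a.+1 - i) k) i (fun x => f x - proj k i f x)).
  - apply: eq_bigr => t _; have := ltn_ord t; rewrite leq_min => /andP[_ tk].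
    by rewrite (proj_in _ _ (Ordinal tk)).
  - lia.
  - by move=> x xa xi; rewrite /proj ifF ?subrr //; lia.
have Phi_ge0 i : (i < m)%N -> 0 <= Phi i.
  move=> im; have [ai|ia] := ltnP a i.
    by rewrite /Phi big1 // => x _; rewrite /proj ifF ?subrr //; have := ltn_ord x; lia.
  rewrite PhiE // -(pmulr_rge0 _ k0R).
  have := @centred_partial_sum_ge k i (minn (a.+1 - i) k) k f
    (f (i + (minn (a.+1 - i) k).-1)%N) 0 k0.
  rewrite subnn mulr0 mul0r; apply.
  - lia.
  - by move=> t tp; apply: df; move: am im; rewrite /nblocks; lia.
  - by move=> t tp; apply: df; move: am im; rewrite /nblocks; lia.
  - by move=> t; lia.
set h' := minn h a.+1.
have hh : (h' <= h)%N by rewrite geq_minl.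
have ha : (h' <= a.+1)%N by rewrite geq_minr.
have D0 : 0 <= f a - f (a + h)%N by rewrite subr_ge0 df //; lia.
have Phi_ge (t : 'I_h') :
    (h' - t)%N%:R * (k%:R / 2) * (f a - f (a + h)%N) <= k%:R * Phi (a.+1 - h' + t)%N.
  have th := ltn_ord t.
  have ep : (a.+1 - (a.+1 - h' + t) = h' - t)%N by lia.
  rewrite PhiE; last by lia.
  rewrite ep (_ : minn _ k = h' - t)%N; last by lia.
  set i := (a.+1 - h' + t)%N.
  (* The first [h' - t] positions of block [i] end at [a], and those from index [h' - t + h - 1] on
     lie at or beyond [a + h]. Since this index is at most [2 * h - 1 <= k / 2], at least half of
     the block is of the latter kind. *)
  have H := @centred_partial_sum_ge k i (h' - t) (h' - t + h - 1) f (f a) (f (a + h)%N) k0.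
  apply: (le_trans _ (H _ _ _ _)).
  - apply: ler_wpM2r => //; apply: ler_wpM2l => //.
    rewrite ler_pdivrMr // -natrM ler_nat; lia.
  - by lia.
  - by move=> s sp; apply: df; move: th am; rewrite /i /nblocks; lia.
  - by move=> s sp; apply: df; move: th am; rewrite /i /nblocks; lia.
  - by move=> s sp; apply: df; move: th am; rewrite /i /nblocks; lia.
have tot : k%:R * \sum_(t < h') Phi (a.+1 - h' + t)%N <= k%:R * \sum_(i < m) Phi i.
  rewrite ler_pM2l //.
  pose Psi i := if (i < m)%N then Phi i else 0.
  have -> : \sum_(i < m) Phi i = \sum_(i < m) Psi i.
    by apply: eq_bigr => i _; rewrite /Psi ltn_ord.
  have -> : \sum_(t < h') Phi (a.+1 - h' + t)%N = \sum_(t < h') Psi (a.+1 - h' + t)%N.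
    by apply: eq_bigr => t _; rewrite /Psi ifT //; move: (ltn_ord t) am; lia.
  apply: sum_shift_le; last by move: am; lia.
  by move=> j; rewrite /Psi; case: ifP => // /Phi_ge0.
have low : (h'%:R ^+ 2 / 2) * ((k%:R / 2) * (f a - f (a + h)%N)) <=
    k%:R * \sum_(t < h') Phi (a.+1 - h' + t)%N.
  apply: (@le_trans _ _ (\sum_(t < h') (h' - t)%N%:R * (k%:R / 2 * (f a - f (a + h)%N)))).
    by rewrite -mulr_suml ler_wpM2r ?sum_rev_ge ?mulr_ge0 ?divr_ge0.
  by rewrite mulr_sumr; apply: ler_sum => t _; rewrite mulrA.
have : k%:R * ((f a - f (a + h)%N) * h'%:R ^+ 2) <= k%:R * (4 * (a.+1%:R * eps)).
  have := ler_wpM2l (ltW k0R) flux; lra.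
by rewrite ler_pM2l.
Qed.

(** The two regimes of [flux_bound]: near the left edge the square is [(a + 1)^2] and one factor
    cancels; elsewhere it is [h^2 >= (k / 8)^2], with [a + 1 <= N] and [256 = 4 * 64]. *)
Definition osc_bound (eps : R) a : R := 4 * eps / a.+1%:R + 256 * eps * N%:R / k%:R ^+ 2.

Lemma osc_bound_decr eps a b : 0 <= eps -> (a <= b)%N -> osc_bound eps b <= osc_bound eps a.
Proof.
move=> e0 ab; rewrite lerD2r ler_wpM2l ?mulr_ge0 // lef_pV2 ?posrE ?ltr0n // ler_nat; lia.
Qed.

(** The largest length allowed by [4 * h <= k + 2] in [flux_bound]; it still satisfies
    [k <= 8 * h]. *)
Let h := ((k + 2) %/ 4)%N.

Lemma short_range_bound f (eps : R) a : decr N f -> 0 <= eps ->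
  (a < m)%N -> (a + h < N)%N ->
  (forall x, (x < N)%N -> m%:R * f x - A1 N k f x <= eps) ->
  f a - f (a + h)%N <= osc_bound eps a.
Proof.
move=> df e0 am ahN hL.
have h1 : (1 <= h)%N by rewrite /h; lia.
have h4 : (4 * h <= k + 2)%N by rewrite /h; lia.
have h8 : (k <= 8 * h)%N by rewrite /h; lia.
have D0 : 0 <= f a - f (a + h)%N by rewrite subr_ge0 df //; lia.
have a0 : 0 < a.+1%:R :> R by rewrite ltr0n.
have k0 : 0 < k%:R :> R by rewrite ltr0n; lia.
have := flux_bound df h1 h4 am ahN hL; rewrite /osc_bound.
have [ha|ah] := leqP h a.+1 => B.
  rewrite ler_wpDl ?mulr_ge0 ?invr_ge0 // ler_pdivlMr ?exprn_gt0 //.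
  have kh : k%:R ^+ 2 <= (8 * h%:R) ^+ 2 :> R.
    by rewrite ler_sqr ?nnegrE ?mulr_ge0 // -natrM ler_nat.
  have aN : a.+1%:R <= N%:R :> R by rewrite ler_nat; move: am; rewrite /nblocks; lia.
  have := ler_wpM2l D0 kh; have := ler_wpM2r e0 aN; lra.
rewrite ler_wpDr ?mulr_ge0 ?invr_ge0 // ler_pdivlMr //.
rewrite -(ler_pM2r a0); lra.
Qed.

Lemma multi_step_bound f (eps : R) a p : decr N f -> 0 <= eps ->
  (a + p * h < m)%N -> (a + p * h < N)%N ->
  (forall x, (x < N)%N -> m%:R * f x - A1 N k f x <= eps) ->
  f a - f (a + p * h)%N <= p%:R * osc_bound eps a.
Proof.
move=> df e0 + + hL; elim: p => [|p IH] pm pN; first by rewrite mul0n addn0 subrr mul0r.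
have h1 : (1 <= h)%N by rewrite /h; lia.
have := IH _ _; rewrite mulSn in pm pN *.
have e : (a + (h + p * h) = a + p * h + h)%N by lia.
have := @short_range_bound f eps (a + p * h) df e0 _ _ hL; rewrite e in pm pN * => H1 H2.
have {}H1 := H1 (leq_ltn_trans (leq_addr _ _) pm) pN.
have {}H2 := H2 (leq_ltn_trans (leq_addr _ _) pm) (leq_ltn_trans (leq_addr _ _) pN).
have := osc_bound_decr e0 (leq_addr (p * h) a).
rewrite -[p.+1]addn1 natrD mulrDl mul1r; lra.
Qed.

(** Eight steps of length [h] cross a block, so the entry at offset [j] is within
    [8 * osc_bound eps j] of the last one. After squaring, the edge terms [1 / (j + 1)^2] have a
    bounded sum and the uniform terms gain a factor [k]. The room on the right keeps all eight steps
    in range. *)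
Lemma bcov_left_bound f (eps : R) i : decr N f -> 0 <= eps ->
  (i + 4 * k + 4 <= N)%N -> (forall x, (x < N)%N -> m%:R * f x - A1 N k f x <= eps) ->
  bcov k i f f <= 64 ^+ 2 * eps ^+ 2 + 128 * 256 ^+ 2 * eps ^+ 2 * N%:R ^+ 2 / k%:R ^+ 3.
Proof.
move=> df e0 ikN hL; have k0 : (0 < k)%N by lia.
have kR : 0 < k%:R :> R by rewrite ltr0n.
apply: (le_trans (bcov_le i f (f (i + k.-1)%N) k0)).
have h8 : (k <= 8 * h)%N by rewrite /h; lia.
have h4 : (4 * h <= k + 2)%N by rewrite /h; lia.
apply: (@le_trans _ _ (\sum_(j < k) (32 * 64 * eps ^+ 2 * (j.+1%:R ^+ 2)^-1
   + 128 * 256 ^+ 2 * eps ^+ 2 * N%:R ^+ 2 / k%:R ^+ 4))).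
  apply: ler_sum => j _; have jk := ltn_ord j.
  have B : f (i + j)%N - f (i + k.-1)%N <= 8 * osc_bound eps j.
    apply: (@le_trans _ _ (f (i + j)%N - f (i + j + 8 * h)%N)).
      by rewrite lerD2l lerN2 df //; lia.
    apply: (@le_trans _ _ (8 * osc_bound eps (i + j))).
      by apply: multi_step_bound => //; rewrite ?/nblocks; lia.
    by rewrite ler_pM2l // osc_bound_decr // leq_addl.
  have D0 : 0 <= f (i + j)%N - f (i + k.-1)%N by rewrite subr_ge0 df //; lia.
  rewrite -sqrrN opprB.
  apply: (@le_trans _ _ ((8 * osc_bound eps j) ^+ 2)).
    by rewrite ler_sqr ?nnegrE // (le_trans D0 B).
  rewrite /osc_bound.
  have -> : 32 * 64 * eps ^+ 2 / j.+1%:R ^+ 2 = 32 * 64 * (eps / j.+1%:R) ^+ 2.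
    by rewrite expr_div_n; ring.
  have -> : 128 * 256 ^+ 2 * eps ^+ 2 * N%:R ^+ 2 / k%:R ^+ 4 =
     128 * 256 ^+ 2 * (eps * N%:R / k%:R ^+ 2) ^+ 2 by field; lra.
  have -> : 4 * eps / j.+1%:R + 256 * eps * N%:R / k%:R ^+ 2 =
     4 * (eps / j.+1%:R) + 256 * (eps * N%:R / k%:R ^+ 2) by ring.
  move: (eps / j.+1%:R) (eps * N%:R / k%:R ^+ 2) => y z.
  have := sqr_ge0 (4 * y - 256 * z); nra.
rewrite big_split /= -mulr_sumr sumr_const card_ord -[_ *+ k]mulr_natr.
apply: lerD; last by rewrite le_eqVlt; apply/orP; left; apply/eqP; field; lra.
have e20 : 0 <= 32 * 64 * eps ^+ 2 by rewrite mulr_ge0 ?sqr_ge0.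
by have := ler_wpM2l e20 (sum_inv_sqr_le k); lra.
Qed.

Definition antisym f := forall x, (x < N)%N -> f (N.-1 - x)%N = - f x.

Lemma bavg_rev f i : antisym f -> (i < m)%N -> bavg k (m.-1 - i) f = - bavg k i f.
Proof.
move=> af im; rewrite /bavg -mulNr -sumrN; congr (_ / _).
rewrite (reindex_inj rev_ord_inj) /=; apply: eq_bigr => j _; have jk := ltn_ord j.
by rewrite -af; [congr f|]; move: im; rewrite /nblocks; lia.
Qed.

Lemma bcov_rev f i : antisym f -> (i < m)%N -> bcov k (m.-1 - i) f f = bcov k i f f.
Proof.
move=> af im; rewrite /bcov bavg_rev //.
rewrite (reindex_inj rev_ord_inj) /=; apply: eq_bigr => j _; have jk := ltn_ord j.
have -> : (m.-1 - i + (k - j.+1) = N.-1 - (i + j))%N by move: im; rewrite /nblocks; lia.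
by rewrite af; [ring|]; move: im; rewrite /nblocks; lia.
Qed.

Lemma antisym_A1 f : antisym f -> antisym (A1 N k f).
Proof.
move=> af x xN; rewrite /A1 (reindex_inj rev_ord_inj) /= -sumrN.
apply: eq_bigr => i _; have im := ltn_ord i; rewrite /proj.
have -> : (m - i.+1 = m.-1 - i)%N by lia.
rewrite bavg_rev // af //.
have -> : ((m.-1 - i <= N.-1 - x < m.-1 - i + k) = (i <= x < i + k))%N.
  by move: im; rewrite /nblocks; lia.
by case: ifP.
Qed.

Lemma antisym_iterA1 n f : antisym f -> antisym (iter n (A1 N k) f).
Proof. by move=> af; elim: n => //= n; apply: antisym_A1. Qed.

(** By antisymmetry a block near the right end has the variance of its mirror image near the left
    end. The mirror image needs room [7 * k + 8], which is at most [11 * k] for [k >= 2]. *)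
Lemma bcov_bound f (eps : R) i : decr N f -> antisym f -> 0 <= eps ->
  (11 * k <= N)%N -> (i < m)%N ->
  (forall x, (x < N)%N -> m%:R * f x - A1 N k f x <= eps) ->
  bcov k i f f <= 64 ^+ 2 * eps ^+ 2 + 128 * 256 ^+ 2 * eps ^+ 2 * N%:R ^+ 2 / k%:R ^+ 3.
Proof.
move=> df af e0 kN11 im hL.
have [iN|Ni] := leqP (i + 4 * k + 4) N; first exact: bcov_left_bound.
rewrite -bcov_rev //; apply: bcov_left_bound => //.
by move: im; rewrite /nblocks; lia.
Qed.

End Regularity.

(** * The cosine profile: norm, Rayleigh quotient and Laplacian *)

Section CosineProfile.
Context {R : realType}.
Implicit Types (t : R).

Lemma sqr_sin_le t : sin t ^+ 2 <= t ^+ 2.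
Proof.
wlog t0 : t / 0 <= t.
  move=> H; have [/H//|t0] := leP 0 t.
  by have := H (- t); rewrite sinN !sqrrN; apply; rewrite oppr_ge0 ltW.
have dsin x : x \in `]0, t[ -> is_derive x 1 sin (cos x) by move=> _; exact: is_derive_sin.
have csin : {within `[0, t], continuous sin}.
  by apply: continuous_subspaceT => y; apply: continuous_sin.
have [c _] := MVT_segment t0 dsin csin.
by rewrite sin0 !subr0 => ->; rewrite exprMn ler_piMl ?sqr_ge0.
Qed.

Lemma one_sub_cos_le t : 1 - cos t <= t ^+ 2 / 2.
Proof.
have e : t = (t / 2) *+ 2 by rewrite -mulr_natr; field.
have -> : cos t = 1 - 2 * sin (t / 2) ^+ 2.
  by rewrite {1}e cos_mulr2n cos2sin2 -mulr_natr; ring.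
have := sqr_sin_le (t / 2); have -> : (t / 2) ^+ 2 = t ^+ 2 / 4 by field.
lra.
Qed.

(** Product formula for the difference, with [|sin t| <= |t|] applied only to the half difference.
    The sine of the midpoint is kept because its squares sum exactly over a period, which makes the
    constant in [crate] sharp. *)
Lemma sqr_cosB_le (x y : R) : (cos x - cos y) ^+ 2 <= (x - y) ^+ 2 * sin ((x + y) / 2) ^+ 2.
Proof.
have -> : cos x = cos ((x + y) / 2 + (x - y) / 2) by congr cos; field.
have -> : cos y = cos ((x + y) / 2 - (x - y) / 2) by congr cos; field.
rewrite cosD cosB; have := sqr_sin_le ((x - y) / 2).
set s := sin ((x + y) / 2); set c := cos ((x + y) / 2); set d := sin _; set e := cos _.
move=> hd; have s0 : 0 <= s ^+ 2 by exact: sqr_ge0.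
have := ler_wpM2r s0 hd; have -> : ((x - y) / 2) ^+ 2 = (x - y) ^+ 2 / 4 by field.
lra.
Qed.

Lemma sum_natr n : \sum_(u < n) (u%:R : R) = n%:R * (n%:R - 1) / 2.
Proof.
elim: n => [|n IH]; first by rewrite big_ord0 !mul0r.
by rewrite big_ord_recr /= IH -[n.+1]addn1 natrD; field.
Qed.

Lemma sum_sqr_natr n :
  \sum_(u < n) (u%:R : R) ^+ 2 = n%:R * (n%:R - 1) * (2 * n%:R - 1) / 6.
Proof.
elim: n => [|n IH]; first by rewrite big_ord0 !mul0r.
by rewrite big_ord_recr /= IH -[n.+1]addn1 natrD; field.
Qed.

Lemma sum_sqr_diff n : \sum_(u < n) \sum_(v < n) (u%:R - v%:R : R) ^+ 2 =
  n%:R ^+ 2 * (n%:R ^+ 2 - 1) / 6.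
Proof.
have e (u : 'I_n) : \sum_(v < n) (u%:R - v%:R : R) ^+ 2 =
   n%:R * u%:R ^+ 2 + \sum_(v < n) (v%:R : R) ^+ 2 - 2 * u%:R * \sum_(v < n) (v%:R : R).
  rewrite mulr_sumr.
  have -> : n%:R * u%:R ^+ 2 = \sum_(v < n) (u%:R : R) ^+ 2.
    by rewrite sumr_const card_ord mulr_natl.
  by rewrite -big_split -sumrB /=; apply: eq_bigr => v _; ring.
rewrite (eq_bigr _ (fun u _ => e u)) sumrB big_split /=.
rewrite -mulr_sumr -mulr_suml -mulr_sumr sumr_const card_ord -[_ *+ n]mulr_natl.
by rewrite sum_natr sum_sqr_natr; field.
Qed.

Lemma bcov_pairs k i (f : nat -> R) : (0 < k)%N -> bcov k i f f =
  (2 * k%:R)^-1 * \sum_(u < k) \sum_(v < k) (f (i + u)%N - f (i + v)%N) ^+ 2.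
Proof.
move=> k0; have k0R : k%:R != 0 :> R by rewrite pnatr_eq0 -lt0n.
under eq_bigr do rewrite sum_sqr_sub //.
rewrite big_split /= -mulr_sumr sumr_const card_ord -[_ *+ k]mulr_natl.
have -> : \sum_(u < k) (f (i + u)%N - bavg k i f) ^+ 2 = bcov k i f f.
  by apply: eq_bigr => u _; rewrite expr2.
by field.
Qed.

Context (N : nat) (N2 : (2 <= N)%N).
Let theta : R := pi / N%:R.
(** The slowest nonconstant mode of the reflected nearest-neighbour walk on [N] points; the
    half-integer shift makes it antisymmetric under [x -> N - 1 - x]. *)
Definition cprof (x : nat) : R := cos (pi / N%:R * (x%:R + 2^-1)).

Let N0 : 0 < N%:R :> R. Proof. by rewrite ltr0n; lia. Qed.
Let theta_gt0 : 0 < theta. Proof. by rewrite divr_gt0 ?pi_gt0. Qed.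
Let thetaN : theta * N%:R = pi. Proof. by rewrite divfK ?gt_eqF. Qed.

Let theta_range (x : nat) : (x < N)%N -> 0 <= theta * (x%:R + 2^-1) <= pi.
Proof.
move=> xN; rewrite mulr_ge0 ?addr_ge0 ?invr_ge0 ?(ltW theta_gt0) //=.
rewrite -thetaN ler_pM2l //.
have : x.+1%:R <= N%:R :> R by rewrite ler_nat.
by rewrite -[x.+1]addn1 natrD; lra.
Qed.

Lemma cprof_le1 x : cprof x <= 1. Proof. exact: cos_le1. Qed.
Lemma cprof_geN1 x : -1 <= cprof x. Proof. exact: cos_geN1. Qed.

Lemma sqr_cprof_le1 x : cprof x ^+ 2 <= 1.
Proof. by have := cprof_le1 x; have := cprof_geN1 x; nra. Qed.

Lemma cprof_decr : decr N cprof.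
Proof.
move=> x y /andP[xy yN]; have [->//|nxy] := eqVneq x y.
apply: ltW; rewrite /cprof ltr_cos ?in_itv /= ?theta_range //; last lia.
by rewrite ltr_pM2l // ltrD2r ltr_nat; lia.
Qed.

Lemma cprof_antisym : antisym N cprof.
Proof.
move=> x xN; rewrite /cprof -cosDpi -[in RHS]cosN -[in RHS]cosD2pi; congr cos.
have -> : (N.-1 - x)%N%:R = N%:R - 1 - x%:R :> R.
  rewrite -[1]/(1%:R) -natrB; last lia.
  by rewrite -natrB; [congr (_%:R); lia|lia].
by rewrite -/theta -thetaN; field.
Qed.

(** Multiplication by [2 * sin theta] telescopes the sum, and [N] steps of [2 * theta] make a full
    turn. *)
Let sum_cos_period (c : R) : \sum_(i < N) cos (2 * theta * (i%:R + c)) = 0.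
Proof.
have st : 0 < sin theta.
  rewrite sin_gt0_pi // theta_gt0 /= -thetaN ltr_pMr // ltr1n; lia.
have tel n : 2 * sin theta * \sum_(i < n) cos (2 * theta * (i%:R + c)) =
   sin (2 * theta * (n%:R + c) - theta) - sin (2 * theta * c - theta).
  elim: n => [|n IH]; first by rewrite big_ord0 mulr0 add0r subrr.
  rewrite big_ord_recr /= mulrDr IH -[n.+1]addn1 natrD.
  have -> : 2 * theta * (n%:R + 1 + c) - theta = 2 * theta * (n%:R + c) + theta by ring.
  move: (2 * theta * (n%:R + c)) (sin (2 * theta * c - theta)) => X Y.
  by rewrite sinB sinD; ring.
have := tel N.
have -> : 2 * theta * (N%:R + c) - theta = 2 * theta * c - theta + pi *+ 2.
  by rewrite -thetaN; ring.
rewrite sinD2pi subrr => /eqP; rewrite mulf_eq0 => /orP[|/eqP//].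
by rewrite mulf_eq0 (gt_eqF st) pnatr_eq0.
Qed.

Let sum_sqr_sin (c : R) : \sum_(i < N) sin (theta * (i%:R + c)) ^+ 2 = N%:R / 2.
Proof.
have := sum_cos_period c.
have -> : \sum_(i < N) cos (2 * theta * (i%:R + c)) =
   \sum_(i < N) (1 - 2 * sin (theta * (i%:R + c)) ^+ 2).
  apply: eq_bigr => i _; have -> : 2 * theta * (i%:R + c) = (theta * (i%:R + c)) *+ 2.
    by ring.
  by rewrite cos_mulr2n cos2sin2; ring.
by rewrite sumrB -mulr_sumr sumr_const card_ord; lra.
Qed.

Lemma ip_cprof : ip N cprof cprof = N%:R / 2.
Proof.
have := sum_sqr_sin 2^-1; rewrite /ip.
have -> : \sum_(x < N) cprof x * cprof x =
   \sum_(x < N) (1 - sin (theta * (x%:R + 2^-1)) ^+ 2).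
  by apply: eq_bigr => x _; rewrite -expr2 /cprof cos2sin2.
by rewrite sumrB sumr_const card_ord; lra.
Qed.

Context (k : nat) (k2 : (2 <= k)%N) (kN : (k <= N)%N).
Local Notation m := (nblocks N k).

Definition crate : R := pi ^+ 2 * (k%:R * (k%:R ^+ 2 - 1)) / (12 * N%:R ^+ 2).

(** A pair [(u, v)] of offsets contributes [theta^2 (u - v)^2] times a squared sine; extended from
    [m] to [N] terms, these squares sum to [N / 2]. The pairs give [k^2 (k^2 - 1) / 6], hence the
    factor [k (k^2 - 1) / 12]. *)
Lemma sum_bcov_cprof_le :
  \sum_(i < m) bcov k i cprof cprof <= crate * ip N cprof cprof.
Proof.
have k0 : 0 < k%:R :> R by rewrite ltr0n; lia.
under eq_bigr do rewrite (bcov_pairs _ _ (ltnW k2)).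
rewrite -mulr_sumr exchange_big /=.
have H (u v : 'I_k) : \sum_(i < m) (cprof (i + u) - cprof (i + v)) ^+ 2 <=
    (u%:R - v%:R) ^+ 2 * (theta ^+ 2 * (N%:R / 2)).
  rewrite -(sum_sqr_sin ((u%:R + v%:R + 1) / 2)) !mulr_sumr.
  pose g (i : nat) := (u%:R - v%:R) ^+ 2 *
    (theta ^+ 2 * sin (theta * (i%:R + (u%:R + v%:R + 1) / 2)) ^+ 2).
  apply: (@le_trans _ _ (\sum_(i < m) g i)).
    apply: ler_sum => i _; rewrite /cprof -/theta.
    apply: (le_trans (sqr_cosB_le _ _)); rewrite /g !natrD.
    have -> : (theta * (i%:R + u%:R + 2^-1) + theta * (i%:R + v%:R + 2^-1)) / 2 =
      theta * (i%:R + (u%:R + v%:R + 1) / 2) by field.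
    by rewrite le_eqVlt; apply/orP; left; apply/eqP; ring.
  apply: (@sum_shift_le _ g 0); last by rewrite /nblocks; lia.
  by move=> j; apply: mulr_ge0; [exact: sqr_ge0 | apply: mulr_ge0; exact: sqr_ge0].
apply: (@le_trans _ _ ((2 * k%:R)^-1 *
   \sum_(u < k) \sum_(v < k) (u%:R - v%:R) ^+ 2 * (theta ^+ 2 * (N%:R / 2)))).
  rewrite ler_wpM2l ?invr_ge0 ?mulr_ge0 //; apply: ler_sum => u _.
  by rewrite exchange_big /=; apply: ler_sum => v _.
under eq_bigr do rewrite -mulr_suml; rewrite -mulr_suml sum_sqr_diff ip_cprof.
rewrite le_eqVlt; apply/orP; left; apply/eqP; rewrite /crate /theta.
by field; rewrite !lt0r_neq0.
Qed.

(** Only the blocks starting at [x + 1 - k, ..., x] contain [x], so at most [k] terms survive; the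
    range is enlarged so that this whole window fits in it. *)
Let sum_block_le (T : nat -> R) (E : R) (x : nat) : 0 <= E ->
  (forall i, (i < m)%N -> (i <= x < i + k)%N -> T i <= E) ->
  (forall i, ~~ (i <= x < i + k)%N -> T i = 0) -> \sum_(i < m) T i <= k%:R * E.
Proof.
move=> E0 TE T0; pose g i := if (i <= x < i + k)%N then E else 0.
have g0 i : 0 <= g i by rewrite /g; case: ifP.
apply: (@le_trans _ _ (\sum_(i < m) g i)).
  apply: ler_sum => i _; rewrite /g; case: ifP => xi; first exact: TE.
  by rewrite T0 ?xi.
apply: (@le_trans _ _ (\sum_(i < m + x.+1 + k) g i)).
  by apply: (@sum_shift_le _ g 0) => //; lia.
rewrite (@sum_supported_block _ (m + x.+1 + k) k (x.+1 - k)).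
- apply: (@le_trans _ _ (\sum_(j < k) E)).
    by apply: ler_sum => j _; rewrite /g; case: ifP.
  by rewrite sumr_const card_ord -[_ *+ k]mulr_natl.
- lia.
- by move=> i _ h; rewrite /g ifF //; lia.
Qed.

(** [y] and [z] are mirror images about [x], so the sum is [2 cos (.) (1 - cos (theta * d))] with
    [|d| <= k]. *)
Let cprof_pair x y z : (y + z = x + x)%N -> (y <= x + k)%N -> (x <= y + k)%N ->
  cprof x - cprof y + (cprof x - cprof z) <= theta ^+ 2 * k%:R ^+ 2.
Proof.
move=> yz yx xy; pose d : R := y%:R - x%:R.
have zE : z%:R = x%:R - d :> R.
  have : y%:R + z%:R = x%:R + x%:R :> R by rewrite -!natrD yz.
  by rewrite /d; lra.
have dk : d ^+ 2 <= k%:R ^+ 2.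
  have : y%:R <= x%:R + k%:R :> R by rewrite -natrD ler_nat.
  have : x%:R <= y%:R + k%:R :> R by rewrite -natrD ler_nat.
  by rewrite /d; nra.
have yE : y%:R = x%:R + d :> R by rewrite /d; ring.
rewrite /cprof -/theta.
have -> : theta * (y%:R + 2^-1) = theta * (x%:R + 2^-1) + theta * d by rewrite yE; ring.
have -> : theta * (z%:R + 2^-1) = theta * (x%:R + 2^-1) - theta * d by rewrite zE; ring.
rewrite cosD cosB; have := one_sub_cos_le (theta * d); rewrite exprMn.
have := ler_wpM2l (sqr_ge0 theta) dk; have := cos_le1 (theta * d).
have := cos_le1 (theta * (x%:R + 2^-1)).
move: (cos _) (cos _) (sin _) (sin _) => c1 c2 s1 s2; nra.
Qed.

(** At most [k] blocks matter, each contributing order [theta^2 k^2]. Near the left end all values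
    involved are close to [1]; near the right end [cprof x] is close to its lower bound [-1]. In the
    bulk, reversing both the block index and the offset pairs each point with its mirror image about
    [x], so first-order terms cancel. *)
Lemma cprof_laplacian_le x : (x < N)%N ->
  m%:R * cprof x - A1 N k cprof x <= 2 * (pi / N%:R) ^+ 2 * k%:R ^+ 3.
Proof.
move=> xN; rewrite -/theta; have k0 : (0 < k)%N by lia.
have k0R : 0 < k%:R :> R by rewrite ltr0n.
have t0 := ltW theta_gt0.
pose T i := cprof x - proj k i cprof x.
have -> : m%:R * cprof x - A1 N k cprof x = \sum_(i < m) T i.
  by rewrite sumrB sumr_const card_ord mulr_natl.
have T0 i : ~~ (i <= x < i + k)%N -> T i = 0.
  by move=> /negbTE h; rewrite /T /proj h subrr.
have E0 : 0 <= 2 * theta ^+ 2 * k%:R ^+ 2.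
  by rewrite mulr_ge0 ?sqr_ge0 // mulr_ge0 ?sqr_ge0.
have eE : 2 * theta ^+ 2 * k%:R ^+ 3 = k%:R * (2 * theta ^+ 2 * k%:R ^+ 2) by ring.
have near0 y : (y.+1 <= 2 * k)%N -> 1 - cprof y <= 2 * theta ^+ 2 * k%:R ^+ 2.
  move=> yk; apply: (le_trans (one_sub_cos_le _)); rewrite -/theta.
  have y0 : 0 <= y%:R :> R by [].
  have : y%:R + 1 <= 2 * k%:R :> R by rewrite -[1]/(1%:R) -natrD -natrM ler_nat; lia.
  move=> yk'; have : (y%:R + 2^-1) ^+ 2 <= (2 * k%:R) ^+ 2 :> R by rewrite ler_sqr ?nnegrE; lra.
  by move=> h; have := ler_wpM2l (sqr_ge0 theta) h; rewrite !exprMn; lra.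
have [xk|kx] := ltnP x.+1 k.
  rewrite eE; apply: (@sum_block_le T _ x E0 _ T0) => i im xi.
  rewrite /T /proj xi lerBlDl -lerBlDr; apply: bavg_ge => // j jk.
  have h : 1 - cprof (i + j) <= 2 * theta ^+ 2 * k%:R ^+ 2 by apply: near0; lia.
  by have := cprof_le1 x; lra.
have [xm|mx] := ltnP x m; last first.
  rewrite eE; apply: (@sum_block_le T _ x E0 _ T0) => i im xi.
  rewrite /T /proj xi lerBlDl -lerBlDr; apply: bavg_ge => // j jk.
  have h : 1 - cprof (N.-1 - x) <= 2 * theta ^+ 2 * k%:R ^+ 2.
    by apply: near0; move: mx; rewrite /nblocks; lia.
  by rewrite cprof_antisym // in h; have := cprof_geN1 (i + j); lra.
pose s := (x.+1 - k)%N.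
rewrite (@sum_supported_block _ m k s T); last first.
- by move=> i _ h; apply: T0; rewrite /s in h; lia.
- by rewrite /s; lia.
have TE (u : 'I_k) : T (s + u)%N =
    k%:R^-1 * \sum_(v < k) (cprof x - cprof (s + u + v)%N).
  have := ltn_ord u => uk; rewrite /T /proj ifT; last by rewrite /s; lia.
  rewrite sumrB sumr_const card_ord -[cprof x *+ k]mulr_natl /bavg mulrBr mulKf ?gt_eqF //.
  by rewrite mulrC.
rewrite (eq_bigr _ (fun u _ => TE u)) -mulr_sumr.
set S := \sum_(u < k) _.
have S2 : 2 * S <= k%:R * (k%:R * (theta ^+ 2 * k%:R ^+ 2)).
  have eS : S = \sum_(u < k) \sum_(v < k) (cprof x - cprof (s + (k - u.+1) + (k - v.+1))%N).
    rewrite /S (reindex_inj rev_ord_inj) /=; apply: eq_bigr => u _.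
    by rewrite (reindex_inj rev_ord_inj) /=; apply: eq_bigr => v _.
  have -> : 2 * S = S + S by ring.
  rewrite {2}eS /S -big_split /=.
  have cst (c : R) : k%:R * c = \sum_(u < k) c.
    by rewrite sumr_const card_ord mulr_natl.
  rewrite 2!cst; apply: ler_sum => u _; rewrite -big_split /=; apply: ler_sum => v _.
  by apply: cprof_pair; have := ltn_ord u; have := ltn_ord v; rewrite /s; lia.
rewrite mulrC ler_pdivrMr //.
have P : 0 <= theta ^+ 2 * k%:R ^+ 4 by rewrite mulr_ge0 ?sqr_ge0 ?exprn_ge0.
lra.
Qed.

End CosineProfile.

(** * Moments under a uniform permutation *)

Section SymmetricAverages.
Context {R : realType} (k : nat).
Implicit Types (g b : 'I_k -> R).

Lemma sum_comp_inj (I : finType) (h : I -> I) (F : I -> R) : injective h ->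
  \sum_i F (h i) = \sum_i F i.
Proof. by move=> hi; rewrite [RHS](reindex_inj hi). Qed.

(** Composing with a transposition shows that the sum does not depend on [j]; summing over all [j]
    then makes each permutation contribute the full sum of [g]. *)
Lemma sum_perm_at g (j : 'I_k) :
  k%:R * \sum_(s : {perm 'I_k}) g (s j) = k`!%:R * \sum_(v < k) g v.
Proof.
pose W j := \sum_(s : {perm 'I_k}) g (s j).
have WE j' : W j' = W j.
  rewrite /W (reindex_inj (mulgI (tperm j' j))) /=.
  by apply: eq_bigr => s _; rewrite permM tpermL.
have -> : k%:R * \sum_(s : {perm 'I_k}) g (s j) = \sum_(j' < k) W j'.
  by rewrite (eq_bigr _ (fun j' _ => WE j')) sumr_const card_ord mulr_natl.
rewrite /W exchange_big /=.
under eq_bigr => s _ do rewrite (sum_comp_inj g (@perm_inj _ s)).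
by rewrite sumr_const card_Sn mulr_natl.
Qed.

(* The off-diagonal correlations of a centred family under a uniform permutation
   are all equal, hence equal to minus the diagonal one divided by [k - 1]. *)
Lemma sum_perm_sqr_le (a : 'I_k -> R) b : (2 <= k)%N -> (forall x, a x ^+ 2 <= 1) ->
  \sum_x b x = 0 ->
  \sum_(s : {perm 'I_k}) (\sum_x a x * b (s x)) ^+ 2 <= k`!%:R * (2 * \sum_x b x ^+ 2).
Proof.
move=> k2 a1 b0; pose T x y := \sum_(s : {perm 'I_k}) b (s x) * b (s y).
have kR : 2 <= k%:R :> R by rewrite ler_nat.
have Ty x y y' : x != y -> x != y' -> T x y = T x y'.
  move=> xy xy'; rewrite /T (reindex_inj (mulgI (tperm y y'))) /=.
  by apply: eq_bigr => s _; rewrite !permM tpermL tpermD // eq_sym.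
have Tsum x : \sum_y T x y = 0.
  rewrite /T exchange_big /= big1 // => s _.
  by rewrite -mulr_sumr (sum_comp_inj b (@perm_inj _ s)) b0 mulr0.
have Toff x y : x != y -> (k%:R - 1) * T x y = - T x x.
  move=> xy; have := Tsum x; rewrite (bigD1 x) //=.
  rewrite (eq_bigr (fun=> T x y)); last by move=> z zx; apply: Ty; rewrite // eq_sym.
  rewrite sumr_const cardC1 card_ord -[T x y *+ _]mulr_natl.
  by rewrite -subn1 natrB ?(ltnW k2) // => /eqP; rewrite addrC addr_eq0 => /eqP.
have Tdiag x : k%:R * T x x = k`!%:R * \sum_x b x ^+ 2.
  by rewrite -(sum_perm_at (fun v => b v ^+ 2) x); under [in RHS]eq_bigr do rewrite expr2.
have -> : \sum_(s : {perm 'I_k}) (\sum_x a x * b (s x)) ^+ 2 =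
    \sum_x \sum_y a x * a y * T x y.
  under eq_bigr do rewrite expr2 big_distrlr /=.
  rewrite exchange_big /=; apply: eq_bigr => x _.
  rewrite exchange_big /=; apply: eq_bigr => y _.
  by rewrite mulr_sumr; apply: eq_bigr => s _; ring.
pose al := k`!%:R * (\sum_x b x ^+ 2) / k%:R.
have al0 : 0 <= al by rewrite divr_ge0 ?mulr_ge0 ?sumr_ge0 // => *; exact: sqr_ge0.
have Txx x : T x x = al.
  have kn : k%:R != 0 :> R by apply: lt0r_neq0; lra.
  by apply: (mulfI kn); rewrite Tdiag /al [RHS]mulrC divfK.
have TE x y : T x y = (if x == y then al else 0) * (k%:R / (k%:R - 1)) - al / (k%:R - 1).
  have k1 : k%:R - 1 != 0 :> R by apply: lt0r_neq0; lra.
  apply: (mulfI k1); case: eqVneq => [->|xy]; first by rewrite Txx; field.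
  by rewrite Toff // Txx; field.
have -> : \sum_x \sum_y a x * a y * T x y =
   k%:R / (k%:R - 1) * al * \sum_x a x ^+ 2 - al / (k%:R - 1) * (\sum_x a x) ^+ 2.
  rewrite expr2 big_distrlr /= !mulr_sumr -sumrB; apply: eq_bigr => x _.
  have -> : k%:R / (k%:R - 1) * al * a x ^+ 2 = \sum_y (if x == y then
     a x * a y * (al * (k%:R / (k%:R - 1))) else 0).
    by rewrite -big_mkcond /= (big_pred1 x) => [|y]; [ring | rewrite /= eq_sym].
  rewrite mulr_sumr -sumrB; apply: eq_bigr => y _; rewrite TE; case: ifP => _; ring.
have asum : \sum_x a x ^+ 2 <= k%:R.
  apply: (@le_trans _ _ (\sum_(x < k) (1 : R))); first by apply: ler_sum => x _.
  by rewrite sumr_const card_ord.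
have k1 : 0 < k%:R - 1 :> R by lra.
have P1 : 0 <= al / (k%:R - 1) * (\sum_x a x) ^+ 2.
  by rewrite mulr_ge0 ?sqr_ge0 // divr_ge0 // ltW.
have kk : k%:R / (k%:R - 1) <= 2 :> R by rewrite ler_pdivrMr //; lra.
have c0 : 0 <= k%:R / (k%:R - 1) :> R by rewrite divr_ge0 // ltW.
have s0 : 0 <= \sum_x a x ^+ 2 by rewrite sumr_ge0 // => *; exact: sqr_ge0.
have e : k`!%:R * (2 * \sum_x b x ^+ 2) = 2 * al * k%:R.
  have kn : k%:R != 0 :> R by apply: lt0r_neq0; lra.
  by rewrite /al -mulrA divfK //; ring.
rewrite e; apply: (@le_trans _ _ (k%:R / (k%:R - 1) * al * \sum_x a x ^+ 2)); first by lra.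
apply: ler_pM => //; first exact: mulr_ge0.
exact: ler_wpM2r.
Qed.

End SymmetricAverages.

(** * Block rearrangements as group elements, and the deck operator *)

Section BlockRearrangements.
Context {R : realType} (N k : nat) (k2 : (2 <= k)%N) (kN : (k <= N)%N).
Local Notation m := (nblocks N k).
Implicit Types (f : nat -> R) (G : {perm 'I_N} -> R) (eta zeta : {perm 'I_N}).

Let k0 : (0 < k)%N. Proof. exact: ltnW. Qed.
Let kf : k`!%:R != 0 :> R. Proof. by rewrite pnatr_eq0 -lt0n fact_gt0. Qed.
Let kfV : 0 <= (k`!%:R : R)^-1. Proof. by rewrite invr_ge0. Qed.

Lemma perm_natE n (s : {perm 'I_n}) (j : 'I_n) : perm_nat s j = s j.
Proof. by rewrite /perm_nat valK. Qed.

Lemma perm_nat_lt n (s : {perm 'I_n}) j : (j < n)%N -> (perm_nat s j < n)%N.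
Proof. by move=> jn; rewrite (perm_natE s (Ordinal jn)). Qed.

Lemma perm_natM n (s t : {perm 'I_n}) j : perm_nat (s * t)%g j = perm_nat t (perm_nat s j).
Proof.
rewrite /perm_nat; case: insubP => [x jn xj|]; first by rewrite permM valK.
by move=> jn; rewrite insubF // (negbTE jn).
Qed.

Lemma val_blk_pos i (s : {perm 'I_k}) (x : 'I_N) : (i + k <= N)%N -> blk_pos i s x =
  (if (i <= x < i + k)%N then i + perm_nat s (x - i) else x)%N :> nat.
Proof.
move=> ikN; rewrite /blk_pos; case: ifP => // xi.
by rewrite insubdK // -topredE /=; have := @perm_nat_lt k s (x - i); lia.
Qed.

(** [blk_pos] packaged as a permutation. The default [1] is not reached when the block fits, since
    [blk_pos i s^-1] inverts [blk_pos i s]. *)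
Definition bperm i (s : {perm 'I_k}) : {perm 'I_N} :=
  insubd (1%g : {perm 'I_N}) (finfun (blk_pos i s : 'I_N -> 'I_N)).

Lemma blk_posM i (s t : {perm 'I_k}) (x : 'I_N) : (i + k <= N)%N ->
  blk_pos i t (blk_pos i s x) = blk_pos i (s * t)%g x.
Proof.
move=> ikN; apply: val_inj; rewrite /= !val_blk_pos //.
have [xi|/negbTE xi] := boolP (i <= x < i + k)%N; last by rewrite !xi.
by rewrite ifT ?addKn ?perm_natM //; have := @perm_nat_lt k s (x - i); lia.
Qed.

Lemma blk_pos1 i (x : 'I_N) : (i + k <= N)%N -> blk_pos i (1%g : {perm 'I_k}) x = x.
Proof.
move=> ikN; apply: val_inj; rewrite /= val_blk_pos //; case: ifP => // xi.
have xk : (x - i < k)%N by lia.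
by rewrite (perm_natE _ (Ordinal xk)) perm1 /=; lia.
Qed.

Lemma bpermE i s (x : 'I_N) : (i + k <= N)%N -> bperm i s x = blk_pos i s x.
Proof.
move=> ikN; rewrite -pvalE /bperm (_ : pval _ = finfun (blk_pos i s : 'I_N -> 'I_N)) ?ffunE //.
apply: insubdK; apply/injectiveP => y z; rewrite !ffunE => yz.
by have := congr1 (blk_pos i s^-1%g) yz; rewrite !blk_posM // mulgV !blk_pos1.
Qed.

Lemma bpermM i s t : (i + k <= N)%N -> bperm i (s * t)%g = (bperm i s * bperm i t)%g.
Proof. by move=> ikN; apply/permP => x; rewrite permM !bpermE // blk_posM. Qed.

Lemma bpermV i s : (i + k <= N)%N -> bperm i s^-1%g = (bperm i s)^-1%g.
Proof.
move=> ikN; apply/eqP; rewrite eq_mulgV1 invgK -bpermM // mulVg.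
by apply/eqP/permP => x; rewrite bpermE // blk_pos1 // perm1.
Qed.

Lemma val_bperm i s (x : 'I_N) : (i + k <= N)%N -> bperm i s x =
  (if (i <= x < i + k)%N then i + perm_nat s (x - i) else x)%N :> nat.
Proof. by move=> ikN; rewrite bpermE // val_blk_pos. Qed.

Lemma perm_avg_cst (c : R) : (k`!%:R)^-1 * \sum_(s : {perm 'I_k}) c = c.
Proof. by rewrite sumr_const card_Sn -[c *+ k`!]mulr_natl mulKf. Qed.

(** A uniform rearrangement sends a position of the block to a uniform position of the block. *)
Lemma avg_bperm i f (x : 'I_N) : (i + k <= N)%N ->
  (k`!%:R)^-1 * \sum_(s : {perm 'I_k}) f (bperm i s x) = proj k i f x.
Proof.
move=> ikN; under eq_bigr do rewrite val_bperm //.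
rewrite /proj; case: ifP => xi; last first.
  exact: perm_avg_cst.
have xk : (x - i < k)%N by lia.
have h := @sum_perm_at R k (fun j => f (i + j)%N) (Ordinal xk).
have -> : \sum_(s : {perm 'I_k}) f (i + perm_nat s (x - i))%N =
    \sum_(s : {perm 'I_k}) f (i + s (Ordinal xk))%N.
  by apply: eq_bigr => s _; rewrite (perm_natE s (Ordinal xk)).
have k0R : k%:R != 0 :> R by rewrite pnatr_eq0 -lt0n.
apply: (mulfI k0R); rewrite mulrCA h mulKf // /bavg mulrC divfK //.
Qed.

(** [Akernel] acting on functions of the deck. As [(s * eta) x = eta (s x)], rearranging positions
    is multiplication on the left. *)
Definition Aop G eta : R :=
  \sum_(i < m) (k`!%:R)^-1 * \sum_(s : {perm 'I_k}) G (bperm i s * eta)%g.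

Lemma Aop_le G G' : (forall eta, G eta <= G' eta) -> forall eta, Aop G eta <= Aop G' eta.
Proof.
move=> GG' eta; apply: ler_sum => i _; rewrite ler_wpM2l //.
by apply: ler_sum => s _; apply: GG'.
Qed.

Lemma iterAop_le n G G' : (forall eta, G eta <= G' eta) ->
  forall eta, iter n Aop G eta <= iter n Aop G' eta.
Proof. by move=> GG'; elim: n => //= n; apply: Aop_le. Qed.

Lemma Aop_lin (a b : R) G G' :
  Aop (fun eta => a * G eta + b * G' eta) = (fun eta => a * Aop G eta + b * Aop G' eta).
Proof.
apply/funext => eta; rewrite /Aop !mulr_sumr -big_split /=; apply: eq_bigr => i _.
by rewrite big_split /= -!mulr_sumr; ring.
Qed.

Lemma iterAop_lin n (a b : R) G G' : iter n Aop (fun eta => a * G eta + b * G' eta) =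
  (fun eta => a * iter n Aop G eta + b * iter n Aop G' eta).
Proof. by elim: n => //= n ->; rewrite Aop_lin. Qed.

Lemma iterAop_cst n (c : R) : iter n Aop (fun=> c) = (fun=> m%:R ^+ n * c).
Proof.
elim: n => [|n /= ->]; first by apply/funext => ?; rewrite /= mul1r.
apply/funext => eta; rewrite /Aop.
under eq_bigr do rewrite perm_avg_cst.
by rewrite sumr_const card_ord exprS -mulrA mulr_natl.
Qed.

Lemma iterAop_sum n (I : finType) (G : I -> {perm 'I_N} -> R) :
  iter n Aop (fun eta => \sum_i G i eta) = (fun eta => \sum_i iter n Aop (G i) eta).
Proof.
elim: n => //= n ->; apply/funext => eta; rewrite /Aop exchange_big /=.
by apply: eq_bigr => i _; rewrite -mulr_sumr exchange_big.
Qed.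

(** Stationarity of the uniform law: left multiplication by a fixed permutation is a bijection of
    the decks. *)
Lemma sum_iterAop n G : \sum_eta iter n Aop G eta = m%:R ^+ n * \sum_eta G eta.
Proof.
elim: n => [|n IH] /=; first by rewrite mul1r.
rewrite /Aop exchange_big /= exprS -mulrA -IH.
rewrite (eq_bigr (fun=> \sum_eta iter n Aop G eta)); last first.
  move=> i _; rewrite -mulr_sumr exchange_big /=.
  under eq_bigr => s _ do rewrite (sum_comp_inj (iter n Aop G) (mulgI (bperm i s))).
  exact: perm_avg_cst.
by rewrite sumr_const card_ord mulr_natl.
Qed.

Lemma is_rearrE i s eta zeta : (i + k <= N)%N ->
  is_rearr i s eta zeta = (zeta == bperm i s * eta)%g.
Proof.
move=> ikN; apply/forallP/eqP => [h|-> x]; last by rewrite permM bpermE.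
by apply/permP => x; rewrite permM bpermE //; exact/eqP.
Qed.

Lemma sum_Akernel G eta : \sum_zeta Akernel R k eta zeta * G zeta = Aop G eta.
Proof.
rewrite /Akernel; under eq_bigr do rewrite big_mkord mulr_suml.
rewrite exchange_big /=; apply: eq_bigr => i _.
have ikN := nblocks_le kN (ltn_ord i).
under eq_bigr do rewrite -mulrA mulr_suml; rewrite -mulr_sumr; congr (_ * _).
rewrite exchange_big /=; apply: eq_bigr => s _.
rewrite (bigD1 (bperm i s * eta)%g) //= [X in X + _](_ : _ = G (bperm i s * eta)%g).
  rewrite big1 ?addr0 //.
  by move=> z /negbTE zn; rewrite (is_rearrE _ _ _ ikN) zn mul0r.
by rewrite (is_rearrE _ _ _ ikN) eqxx mul1r.
Qed.

Lemma sum_Apow n G eta : \sum_zeta Apow R k n eta zeta * G zeta = iter n Aop G eta.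
Proof.
elim: n eta => [|n IH] eta /=.
  rewrite (bigD1 eta) //= eqxx mul1r big1 ?addr0 // => z zn.
  by rewrite eq_sym (negbTE zn) mul0r.
under eq_bigr do rewrite mulr_suml; rewrite exchange_big /= -sum_Akernel.
by apply: eq_bigr => z _; rewrite -IH mulr_sumr; apply: eq_bigr => y _; rewrite mulrA.
Qed.

End BlockRearrangements.

(** * Coupling of two decks that differ by a transposition *)

Section Coupling.
Context {R : realType} (N k : nat) (k2 : (2 <= k)%N) (kN : (k <= N)%N).
Local Notation m := (nblocks N k).
Local Notation bperm := (@bperm N k).
Local Notation Aop := (@Aop R N k).
Local Notation A1 := (@A1 R N k).
Implicit Types (f h : nat -> R) (G : {perm 'I_N} -> R) (eta zeta : {perm 'I_N}).

Let k0 : (0 < k)%N. Proof. exact: ltnW. Qed.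
Let kfV : 0 <= (k`!%:R : R)^-1. Proof. by rewrite invr_ge0. Qed.

Lemma bperm_tperm i (u v : 'I_k) (p q : 'I_N) : (i + k <= N)%N ->
  p = (i + u)%N :> nat -> q = (i + v)%N :> nat -> bperm i (tperm u v) = tperm p q.
Proof.
move=> ikN pu qv; have uk := ltn_ord u; have vk := ltn_ord v.
apply/permP => x; apply: val_inj; rewrite /= val_bperm //.
case: tpermP => [->|->|xp xq].
- by rewrite ifT ?pu ?addKn ?perm_natE ?tpermL //; lia.
- by rewrite ifT ?qv ?addKn ?perm_natE ?tpermR //; lia.
case: ifP => // xi; have xk : (x - i < k)%N by lia.
rewrite (perm_natE _ (Ordinal xk)) tpermD /=; first by lia.
  by apply/eqP => e; apply: xp; apply: val_inj; rewrite /= pu e /=; lia.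
by apply/eqP => e; apply: xq; apply: val_inj; rewrite /= qv e /=; lia.
Qed.

(** A position outside the block is fixed and one inside stays inside, so the order can change only
    when both are inside. *)
Lemma bperm_mono i s (p q : 'I_N) : (i + k <= N)%N -> (p <= q)%N ->
  ~~ ((i <= p)%N && (q < i + k)%N) -> (bperm i s p <= bperm i s q)%N.
Proof.
move=> ikN pq npq; rewrite !val_bperm //.
have sp := @perm_nat_lt k s (p - i); have sq := @perm_nat_lt k s (q - i).
by case: ifP => pi; case: ifP => qi; lia.
Qed.

Lemma mul_tpermE (b : {perm 'I_N}) p q :
  (b * tperm p q = tperm (b^-1%g p) (b^-1%g q) * b)%g.
Proof. by rewrite -tpermJ /conjg invgK !mulgA mulgKV. Qed.

(* If both positions lie in the block the two averages agree; otherwise the block step keeps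
   their order, so that the bound averages to the same expression for [proj k i h]. *)
Lemma block_coupling i G h eta (p q : 'I_N) : (i + k <= N)%N -> decr N h ->
  (forall zeta (p q : 'I_N), G zeta - G (tperm p q * zeta)%g <= `|h p - h q|) ->
  (k`!%:R)^-1 * \sum_(s : {perm 'I_k}) G (bperm i s * eta)%g -
  (k`!%:R)^-1 * \sum_(s : {perm 'I_k}) G (bperm i s * (tperm p q * eta))%g <=
  `|proj k i h p - proj k i h q|.
Proof.
move=> ikN dh HG; wlog pq : p q / (p <= q)%N.
  move=> H; have [|/ltnW qp] := leqP p q; first exact: H.
  by rewrite tpermC distrC; apply: H.
have [/andP[pi qi]|npq] := boolP ((i <= p)%N && (q < i + k)%N).
  have uk : (p - i < k)%N by lia.
  have vk : (q - i < k)%N by lia.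
  rewrite -(@bperm_tperm i (Ordinal uk) (Ordinal vk) p q) //=; try lia.
  under [X in _ - _ * X]eq_bigr do rewrite mulgA -bpermM //.
  by rewrite (sum_comp_inj (fun s => G (bperm i s * eta)%g) (mulIg _)) subrr.
rewrite -mulrBr -sumrB.
apply: (@le_trans _ _ ((k`!%:R)^-1 * \sum_(s : {perm 'I_k}) (h (bperm i s p) - h (bperm i s q)))).
  rewrite ler_wpM2l //.
  rewrite -(sum_comp_inj (fun s => h (bperm i s p) - h (bperm i s q)) invg_inj).
  apply: ler_sum => s _; rewrite mulgA mul_tpermE -mulgA -bpermV //.
  apply: (le_trans (HG _ _ _)); rewrite ger0_norm // subr_ge0 dh //.
  by rewrite bperm_mono //=.
by rewrite sumrB mulrBr !avg_bperm // ler_norm.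
Qed.

(** The profile [- x] separates distinct positions by at least [1], which dominates the variation of
    a [[0,1]]-valued function. In the induction step [block_coupling] is summed over the blocks; as
    the iterates stay decreasing, all the differences have the same sign and the absolute values add
    up exactly. *)
Lemma iterAop_tperm_le n G eta (p q : 'I_N) : (forall eta, 0 <= G eta <= 1) ->
  iter n Aop G eta - iter n Aop G (tperm p q * eta)%g <=
  `|iter n A1 (fun x => - x%:R) p - iter n A1 (fun x => - x%:R) q|.
Proof.
move=> G01; have d0 : decr N (fun x => - x%:R : R).
  by move=> x y /andP[xy _]; rewrite lerN2 ler_nat.
elim: n eta p q => [|n IH] eta p q.
  have [->|pq] := eqVneq p q; first by rewrite tperm1 mul1g !subrr normr0.
  apply: (@le_trans _ _ 1) => /=.
    by have := G01 eta; have := G01 (tperm p q * eta)%g; lra.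
  rewrite opprK addrC; have : (p : nat) != q by [].
  rewrite neq_ltn => /orP[] pq'.
    rewrite ger0_norm ?subr_ge0 ?ler_nat ?(ltnW pq') // -natrB ?(ltnW pq') // ler1n; lia.
  rewrite distrC ger0_norm ?subr_ge0 ?ler_nat ?(ltnW pq') // -natrB ?(ltnW pq') // ler1n; lia.
wlog pq : p q / (p <= q)%N.
  move=> H; have [|/ltnW qp] := leqP p q; first exact: H.
  by rewrite tpermC distrC; apply: H.
rewrite !iterS; set h := iter n A1 _ in IH *.
have dh : decr N h by exact: decr_iterA1.
rewrite /Aop -sumrB /A1 -sumrB.
have pr i : (i < m)%N -> 0 <= proj k i h p - proj k i h q.
  move=> im; rewrite subr_ge0; apply: (decr_proj k0 kN (nblocks_le kN im) dh).
  by rewrite pq /=.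
rewrite ger0_norm; last by apply: sumr_ge0 => i _; apply: pr.
apply: ler_sum => i _; rewrite -(ger0_norm (pr _ (ltn_ord i))).
by apply: block_coupling => //; exact: (nblocks_le kN).
Qed.

(** Induction on the number of positions where the decks disagree. If [x] is one of them and [q] is
    where [eta] holds the card [zeta x], swapping [x] and [q] repairs [x] and spoils no position. *)
Lemma perm_path_le G (D : R) : 0 <= D ->
  (forall eta (p q : 'I_N), G eta - G (tperm p q * eta)%g <= D) ->
  forall eta zeta, G eta - G zeta <= N%:R * D.
Proof.
move=> D0 GD.
have H r eta zeta : (#|[pred x | eta x != zeta x]| <= r)%N -> G eta - G zeta <= r%:R * D.
  elim: r eta => [|r IH] eta.
    rewrite leqn0 => /eqP/card0_eq e.
    have -> : eta = zeta.
      by apply/permP => x; have := e x; rewrite !inE => /negbFE/eqP.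
    by rewrite subrr mul0r.
  have [->|nez] := eqVneq eta zeta; first by move=> _; rewrite subrr mulr_ge0.
  have [x xe] : exists x, eta x != zeta x.
    apply/existsP; rewrite -negb_forall; apply: contra nez => /forallP h.
    by apply/eqP/permP => y; exact/eqP.
  pose q := (eta^-1)%g (zeta x); move=> cr.
  have eq : eta q = zeta x by rewrite /q permKV.
  have qx : q != x by apply: contraNneq xe => qx; rewrite -eq qx.
  have le1 : G eta - G (tperm x q * eta)%g <= D by apply: GD.
  have le2 : G (tperm x q * eta)%g - G zeta <= r%:R * D.
    apply: IH; rewrite -ltnS; apply: leq_trans cr; apply: proper_card.
    apply/properP; split.
      apply/fintype.subsetP => y; rewrite !inE permM; case: tpermP => // [->|->].
        by rewrite eq eqxx.
      by move=> _; rewrite eq; apply: contraNneq qx => /perm_inj ->.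
    by exists x; rewrite !inE // permM tpermL eq eqxx.
  by rewrite -[r.+1]addn1 natrD mulrDl mul1r; lra.
have cN eta zeta : (#|[pred x | eta x != zeta x]| <= N)%N.
  by apply: (leq_trans (max_card _)); rewrite card_ord.
by move=> eta zeta; apply: H.
Qed.

Variable rho : R.
Hypotheses (rho0 : 0 < rho)
  (gap : forall f, \sum_(x < N) f x = 0 -> ip N f (A1 f) <= rho * ip N f f).

Lemma sum_A1 f : \sum_(x < N) A1 f x = m%:R * \sum_(x < N) f x.
Proof.
have e (g : nat -> R) : \sum_(x < N) g x = ip N g (fun=> 1) by apply: eq_bigr => x _; rewrite mulr1.
rewrite !e ip_A1C // A1_cst // mulr1 /ip mulr_sumr.
by apply: eq_bigr => x _; rewrite mulr1 mulrC.
Qed.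

Lemma ip_iterA1_contract n f : \sum_(x < N) f x = 0 ->
  ip N (iter n A1 f) (iter n A1 f) <= (rho ^+ n) ^+ 2 * ip N f f.
Proof.
move=> f0; have z0 j : \sum_(x < N) iter j A1 f x = 0.
  by elim: j => //= j IH; rewrite sum_A1 IH mulr0.
elim: n => [|n IH]; first by rewrite expr0 expr1n mul1r.
have := ip_A1_contract k0 kN rho0 (gap (z0 n)) (gap (z0 n.+1)).
move=> h; apply: (le_trans h).
have -> : (rho ^+ n.+1) ^+ 2 * ip N f f = rho ^+ 2 * ((rho ^+ n) ^+ 2 * ip N f f).
  by rewrite [rho ^+ n.+1]exprS; ring.
exact: ler_wpM2l (sqr_ge0 _) _ _ IH.
Qed.

(** Adding the constant [c] centres the profile without changing differences of iterates. The [L^2]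
    contraction then applies, and a single value is at most the norm, initially at most [N^2]. *)
Lemma iterA1_osc_le n (p q : 'I_N) :
  `|iter n A1 (fun x => - x%:R) p - iter n A1 (fun x => - x%:R) q| <=
  2 * (N%:R ^+ 2 * rho ^+ n).
Proof.
have N0 : 0 < N%:R :> R by rewrite ltr0n; lia.
have N1 : 1 <= N%:R :> R by rewrite ler1n; lia.
pose c : R := (\sum_(x < N) x%:R) / N%:R.
pose f (x : nat) : R := 1 * (- x%:R) + 1 * c.
have f0 : \sum_(x < N) f x = 0.
  rewrite /f; under eq_bigr do rewrite !mul1r.
  by rewrite big_split /= sumrN sumr_const card_ord -[c *+ N]mulr_natl /c mulrC divfK ?gt_eqF // addNr.
have c0 : 0 <= c by rewrite divr_ge0 ?sumr_ge0.
have cN : c <= N%:R.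
  rewrite ler_pdivrMr //; apply: (@le_trans _ _ (\sum_(x < N) (N%:R : R))).
    by apply: ler_sum => x _; rewrite ler_nat ltnW.
  by rewrite sumr_const card_ord mulr_natl.
have fN : ip N f f <= (N%:R ^+ 2) ^+ 2.
  apply: (@le_trans _ _ (\sum_(x < N) N%:R ^+ 2)).
    apply: ler_sum => x _; rewrite -expr2 -sqrrN /f !mul1r opprD opprK.
    have : x%:R <= N%:R :> R by rewrite ler_nat ltnW.
    have : 0 <= x%:R :> R by [].
    by nra.
  rewrite sumr_const card_ord -[_ ^+ 2 *+ N]mulr_natl.
  by have := ler_wpM2l (exprn_ge0 3 (ltW N0)) N1; lra.
have fx (x : 'I_N) : `|iter n A1 f x| <= N%:R ^+ 2 * rho ^+ n.
  have b0 : 0 <= N%:R ^+ 2 * rho ^+ n by rewrite mulr_ge0 ?sqr_ge0 ?exprn_ge0 // ltW.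
  rewrite -ler_sqr ?nnegrE // real_normK ?num_real //.
  apply: (@le_trans _ _ (ip N (iter n A1 f) (iter n A1 f))).
    rewrite /ip (bigD1 x) //= expr2 lerDl; apply: sumr_ge0 => y _.
    by rewrite -expr2 sqr_ge0.
  apply: (le_trans (ip_iterA1_contract n f0)); rewrite exprMn mulrC.
  by rewrite ler_wpM2r ?sqr_ge0.
have cE : iter n A1 (fun=> c) = (fun=> iter n A1 (fun=> c) 0%N).
  have [d ->] : exists d, iter n A1 (fun=> c) = (fun=> d) by
    elim: (n) => [|j [d /= ->]]; [exists c | exists (m%:R * d); rewrite A1_cst].
  by [].
have fE (x : 'I_N) : iter n A1 f x = iter n A1 (fun x => - x%:R) x + iter n A1 (fun=> c) 0%N.
  by rewrite /f iterA1_lin // cE !mul1r.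
have -> : iter n A1 (fun x => - x%:R) p - iter n A1 (fun x => - x%:R) q =
   iter n A1 f p - iter n A1 f q by rewrite !fE; ring.
by apply: (le_trans (ler_normB _ _)); have := fx p; have := fx q; lra.
Qed.

Lemma iterAop_diff_le n G eta zeta : (forall eta, 0 <= G eta <= 1) ->
  iter n Aop G eta - iter n Aop G zeta <= 2 * N%:R ^+ 3 * rho ^+ n.
Proof.
move=> G01; have -> : 2 * N%:R ^+ 3 * rho ^+ n = N%:R * (2 * (N%:R ^+ 2 * rho ^+ n)) by ring.
apply: perm_path_le => [|eta' p q].
  by rewrite !mulr_ge0 ?sqr_ge0 ?exprn_ge0 // ltW.
exact: le_trans (iterAop_tperm_le _ _ _ _ G01) (iterA1_osc_le _ _ _).
Qed.

End Coupling.

(** * Second moments of linear statistics *)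

Section SecondMoment.
Context {R : realType} (N k : nat) (k2 : (2 <= k)%N) (kN : (k <= N)%N).
Local Notation m := (nblocks N k).
Local Notation bperm := (@bperm N k).
Local Notation Aop := (@Aop R N k).
Local Notation A1 := (@A1 R N k).
Implicit Types (f v w : nat -> R) (eta : {perm 'I_N}).

Let k0 : (0 < k)%N. Proof. exact: ltnW. Qed.
Let kf : k`!%:R != 0 :> R. Proof. by rewrite pnatr_eq0 -lt0n fact_gt0. Qed.
Let kfV : 0 <= (k`!%:R : R)^-1. Proof. by rewrite invr_ge0. Qed.
Let m0 : 0 <= m%:R :> R. Proof. by []. Qed.

Definition pullback n v (eta : {perm 'I_n}) : nat -> R := fun y => v (perm_nat eta y).
(** Labels are weighted by [v], positions by [f]. Keeping the two apart lets the dynamics act on [f]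
    alone. *)
Definition linstat n v f (eta : {perm 'I_n}) : R := ip n (pullback v eta) f.

Lemma linstat_bperm i s v f eta : (i + k <= N)%N ->
  linstat v f (bperm i s * eta)%g =
  \sum_(x < N) pullback v eta x * f (bperm i s^-1%g x).
Proof.
move=> ikN; rewrite /linstat /ip /pullback.
rewrite -[RHS](sum_comp_inj (fun x : 'I_N => v (perm_nat eta x) * f (bperm i s^-1%g x))
  (@perm_inj _ (bperm i s))).
by apply: eq_bigr => x _; rewrite bpermV // permK !perm_natE permM.
Qed.

Let centred i f (j : 'I_k) := f (i + j)%N - bavg k i f.

Let linstat_split i s f w : (i + k <= N)%N -> \sum_(x < N) w x * f (bperm i s x) =
  ip N w (proj k i f) + \sum_(j < k) w (i + j)%N * centred i f (s j).
Proof.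
move=> ikN; pose d y := w y * (f (perm_nat (bperm i s) y) - proj k i f y).
have -> : \sum_(j < k) w (i + j)%N * centred i f (s j) = \sum_(x < N) d x.
  rewrite (@sum_supported_block _ N k i d) //.
    apply: eq_bigr => j _; have jk := ltn_ord j; have ijN : (i + j < N)%N by lia.
    rewrite /d proj_in (perm_natE _ (Ordinal ijN)) val_bperm //= ifT; last lia.
    by rewrite addKn perm_natE.
  move=> y yN /negbTE yi; rewrite /d (perm_natE _ (Ordinal yN)) val_bperm //= yi.
  by rewrite /proj yi subrr mulr0.
by rewrite /ip -big_split /=; apply: eq_bigr => x _; rewrite /d perm_natE; ring.
Qed.

Let sum_centred i f : \sum_j centred i f j = 0.
Proof. exact: sum_bavg. Qed.

Let sum_perm_centred i f w : \sum_(s : {perm 'I_k}) \sum_(j < k) w j * centred i f (s j) = 0.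
Proof.
rewrite exchange_big /= big1 // => j _; rewrite -mulr_sumr.
have := @sum_perm_at R k (centred i f) j; rewrite sum_centred mulr0 => /eqP.
by rewrite mulf_eq0 pnatr_eq0 eqn0Ngt k0 /= => /eqP ->; rewrite mulr0.
Qed.

Lemma avg_linstat i v f eta : (i + k <= N)%N ->
  (k`!%:R)^-1 * \sum_(s : {perm 'I_k}) linstat v f (bperm i s * eta)%g =
  linstat v (proj k i f) eta.
Proof.
move=> ikN; under eq_bigr do rewrite linstat_bperm //.
rewrite (sum_comp_inj (fun s => \sum_(x < N) pullback v eta x * f (bperm i s x)) invg_inj).
under eq_bigr do rewrite linstat_split //.
rewrite big_split /= (sum_perm_centred i f (fun j => pullback v eta (i + j)%N)) addr0.
exact: perm_avg_cst.
Qed.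

(** Given the block, the statistic is its mean plus a centred fluctuation, so the cross term
    averages out and [sum_perm_sqr_le] bounds the variance. *)
Lemma avg_sqr_linstat i v f eta : (i + k <= N)%N -> (forall y, v y ^+ 2 <= 1) ->
  (k`!%:R)^-1 * \sum_(s : {perm 'I_k}) linstat v f (bperm i s * eta)%g ^+ 2 <=
  linstat v (proj k i f) eta ^+ 2 + 2 * bcov k i f f.
Proof.
move=> ikN v1; under eq_bigr do rewrite linstat_bperm //.
rewrite (sum_comp_inj (fun s => (\sum_(x < N) pullback v eta x * f (bperm i s x)) ^+ 2) invg_inj).
under eq_bigr do rewrite linstat_split // -/(linstat v (proj k i f) eta).
set P := linstat _ _ _; pose X (s : {perm 'I_k}) :=
  \sum_(j < k) pullback v eta (i + j)%N * centred i f (s j).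
have X0 : \sum_s X s = 0 by exact: (sum_perm_centred i f (fun j => pullback v eta (i + j)%N)).
have X2 : \sum_s X s ^+ 2 <= k`!%:R * (2 * bcov k i f f).
  have -> : bcov k i f f = \sum_j centred i f j ^+ 2 by apply: eq_bigr => j _; rewrite expr2.
  exact: (sum_perm_sqr_le k2 (fun j => v1 _) (sum_centred i f)).
have -> : \sum_s (P + X s) ^+ 2 = \sum_(s : {perm 'I_k}) P ^+ 2 + \sum_s X s ^+ 2.
  have X1 : \sum_s 2 * P * X s = 0 by rewrite -mulr_sumr X0 mulr0.
  rewrite (eq_bigr (fun s => P ^+ 2 + X s ^+ 2 + 2 * P * X s)) => [|s _]; last by ring.
  by rewrite !big_split /= X1 addr0.
by rewrite mulrDr perm_avg_cst lerD2l ler_pdivrMl ?ltr0n ?fact_gt0 //.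
Qed.

Lemma Aop_linstat v f : Aop (linstat v f) = linstat v (A1 f).
Proof.
apply/funext => eta; rewrite /Aop /linstat.
under eq_bigr => i _ do rewrite (avg_linstat v f eta (nblocks_le kN (ltn_ord i))).
by rewrite /linstat ip_sym ip_A1l; apply: eq_bigr => i _; rewrite ip_sym.
Qed.

Lemma iterAop_linstat n v f : iter n Aop (linstat v f) = linstat v (iter n A1 f).
Proof. by elim: n => //= n ->; rewrite Aop_linstat. Qed.

(** The sum, over all words of [n] blocks, of the squared pairing of [w] with [f] averaged
    successively along the word: only the choice of blocks remains random. *)
Fixpoint word_energy n w f : R :=
  if n is n'.+1 then \sum_(i < m) word_energy n' w (proj k i f) else ip N w f ^+ 2.

(** Each ring adds variance at most [2 * bcov k i f f], which is twice the drop from [ip N f f] to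
    the squared norm of [proj k i f]. The total therefore telescopes to at most [2 * ip N f f] per
    word. *)
Lemma iterAop_sqr_linstat n v f eta : (forall y, v y ^+ 2 <= 1) ->
  iter n Aop (fun eta => linstat v f eta ^+ 2) eta <=
  word_energy n (pullback v eta) f + 2 * m%:R ^+ n * ip N f f.
Proof.
move=> v1; elim: n f => [|n IH] f.
  by rewrite /= lerDl mulr1 mulr_ge0 ?ip_ge0.
rewrite iterSr; apply: (@le_trans _ _ (iter n Aop (fun eta =>
    \sum_(i < m) (1 * linstat v (proj k i f) eta ^+ 2 + (2 * bcov k i f f) * 1)) eta)).
  apply: iterAop_le => z; rewrite /Aop; apply: ler_sum => i _.
  by rewrite mul1r mulr1; apply: avg_sqr_linstat => //; exact: nblocks_le (ltn_ord i).
rewrite iterAop_sum /= exprS.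
have -> : 2 * (m%:R * m%:R ^+ n) * ip N f f = \sum_(i < m) 2 * m%:R ^+ n * ip N f f.
  by rewrite sumr_const card_ord -[RHS]mulr_natl; ring.
rewrite -big_split /=; apply: ler_sum => i _.
rewrite iterAop_lin // iterAop_cst.
have ikN := nblocks_le kN (ltn_ord i).
have := IH (proj k i f); rewrite ip_proj //; lra.
Qed.

(** Self-adjointness of the projections lets the word be peeled from its other end, on the side of
    [w]. *)
Lemma word_energyS n w f :
  word_energy n.+1 w f = \sum_(i < m) word_energy n (proj k i w) f.
Proof.
elim: n f => [|n IH] f.
  apply: eq_bigr => i _; have ikN := nblocks_le kN (ltn_ord i).
  by rewrite /= ip_projr.
rewrite -[LHS]/(\sum_(i < m) word_energy n.+1 w (proj k i f)).
by under eq_bigr do rewrite IH; rewrite exchange_big.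
Qed.

(** Cauchy-Schwarz through the Lagrange identity. *)
Lemma sqr_bcov_le i f w : bcov k i f w ^+ 2 <= bcov k i f f * bcov k i w w.
Proof.
rewrite /bcov; set a := bavg k i f; set b := bavg k i w.
pose x (j : 'I_k) := f (i + j)%N - a; pose y (j : 'I_k) := w (i + j)%N - b.
rewrite -subr_ge0; suff -> : (\sum_j x j * x j) * (\sum_j y j * y j) - (\sum_j x j * y j) ^+ 2 =
   2^-1 * \sum_u \sum_v (x u * y v - x v * y u) ^+ 2.
  by rewrite mulr_ge0 ?invr_ge0 ?sumr_ge0 // => u _; rewrite sumr_ge0 // => *; exact: sqr_ge0.
have e : \sum_u \sum_v (x u * y v - x v * y u) ^+ 2 =
   \sum_u \sum_v (x u * x u) * (y v * y v) + \sum_u \sum_v (y u * y u) * (x v * x v)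
   - 2 * \sum_u \sum_v (x u * y u) * (x v * y v).
  rewrite mulr_sumr -big_split -sumrB /=; apply: eq_bigr => u _.
  rewrite mulr_sumr -big_split -sumrB /=; apply: eq_bigr => v _; ring.
by rewrite e -!big_distrlr /=; field.
Qed.

(* Only the variance due to the choice of blocks is left; expanding the last block, it is
   controlled by the block variances of the evolved profile [iter n A1 f]. *)
Lemma word_energy_le (Psi : R) f n w :
  (forall n i, (i < m)%N -> bcov k i (iter n A1 f) (iter n A1 f) <= Psi * m%:R ^+ (2 * n)) ->
  m%:R ^+ n * word_energy n w f <=
    ip N w (iter n A1 f) ^+ 2 + Psi * m%:R ^+ (2 * n) * ip N w w.
Proof.
move=> HPsi; elim: n w => [|n IH] w.
  rewrite /= mul1r lerDl mulr1 mulr_ge0 ?ip_ge0 //.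
  have [|m_gt0] := posnP m; first by have := nblocks_gt0 kN; lia.
  have := HPsi 0%N 0%N m_gt0; rewrite muln0 expr0 mulr1 => h.
  exact: le_trans (bcov_ge0 _ _ _) h.
set g := iter n A1 f in IH *; set M := m%:R ^+ (2 * n) in IH *.
have M0 : 0 <= M by rewrite exprn_ge0.
rewrite word_energyS exprS -mulrA mulr_sumr.
apply: (@le_trans _ _ (m%:R * \sum_(i < m) (ip N (proj k i w) g ^+ 2
    + Psi * M * ip N (proj k i w) (proj k i w)))).
  by rewrite ler_wpM2l //; apply: ler_sum => i _; apply: IH.
have e1 (i : 'I_m) : ip N (proj k i w) g = ip N w g - bcov k i w g.
  by rewrite ip_projl // (nblocks_le kN).
have e2 (i : 'I_m) : ip N (proj k i w) (proj k i w) = ip N w w - bcov k i w w.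
  by rewrite ip_proj // (nblocks_le kN).
under eq_bigr do rewrite e1 e2.
have b2 (i : 'I_m) : bcov k i w g ^+ 2 <= Psi * M * bcov k i w w.
  apply: (le_trans (sqr_bcov_le _ _ _)); rewrite mulrC ler_wpM2r ?bcov_ge0 //.
  exact: HPsi.
rewrite iterS -/g -ip_A1C // ip_A1E // mulnS exprD -/M.
set B := \sum_(i < m) bcov k i w g.
apply: (@le_trans _ _ (m%:R * \sum_(i < m) (ip N w g ^+ 2 - 2 * ip N w g * bcov k i w g
    + Psi * M * ip N w w))).
  rewrite ler_wpM2l //; apply: ler_sum => i _; have := b2 i; lra.
have -> : \sum_(i < m) (ip N w g ^+ 2 - 2 * ip N w g * bcov k i w g + Psi * M * ip N w w) =
    m%:R * (ip N w g ^+ 2 + Psi * M * ip N w w) - 2 * ip N w g * B.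
  have cst (c : R) : m%:R * c = \sum_(i < m) c by rewrite sumr_const card_ord mulr_natl.
  have eB : 2 * ip N w g * B = \sum_(i < m) 2 * ip N w g * bcov k i w g by rewrite mulr_sumr.
  by rewrite cst eB -sumrB; apply: eq_bigr => i _; ring.
have := sqr_ge0 B; lra.
Qed.

End SecondMoment.

(** The estimate [sum_perm_sqr_le] with the whole deck as a single block; inversion moves the
    permutation from the labels to the positions. *)
Lemma avg_sqr_linstat_perm {R : realType} N (v f : nat -> R) : (2 <= N)%N ->
  (forall y, v y ^+ 2 <= 1) -> \sum_(x < N) f x = 0 ->
  (N`!%:R)^-1 * \sum_(eta : {perm 'I_N}) linstat v f eta ^+ 2 <= 2 * ip N f f.
Proof.
move=> N2 v1 f0.
have e (eta : {perm 'I_N}) : linstat v f eta^-1%g = \sum_(x < N) v x * f (eta x).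
  rewrite /linstat /ip /pullback.
  rewrite -(sum_comp_inj (fun x : 'I_N => v (perm_nat eta^-1%g x) * f x) (@perm_inj _ eta)).
  by apply: eq_bigr => x _; rewrite perm_natE permK.
rewrite -(sum_comp_inj (fun eta : {perm 'I_N} => linstat v f eta ^+ 2) invg_inj).
under eq_bigr do rewrite e.
have := @sum_perm_sqr_le R N (fun x => v x) (fun x => f x) N2 (fun x => v1 _) f0.
have N0 : 0 < N`!%:R :> R by rewrite ltr0n fact_gt0.
by rewrite ler_pdivrMl.
Qed.

(** * From discrete steps to continuous time and total variation *)

Section HeatKernel.
Context {R : realType} (N k : nat) (k2 : (2 <= k)%N) (kN : (k <= N)%N).
Local Notation m := (nblocks N k).
Local Notation Aop := (@Aop R N k).
Implicit Types (G : {perm 'I_N} -> R) (eta zeta xi : {perm 'I_N}) (t : R).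

Definition expect t eta G : R := \sum_xi heat k t eta xi * G xi.
Definition umean G : R := (N`!%:R)^-1 * \sum_eta G eta.

Let Nf : N`!%:R != 0 :> R. Proof. by rewrite pnatr_eq0 -lt0n fact_gt0. Qed.

Lemma Apow_ge0 n eta xi : 0 <= Apow R k n eta xi.
Proof.
elim: n eta => [|n IH] eta //=; apply: sumr_ge0 => z _; rewrite mulr_ge0 // /Akernel.
by apply: sumr_ge0 => i _; rewrite mulr_ge0 ?invr_ge0 ?sumr_ge0.
Qed.

Lemma Apow_le n eta xi : Apow R k n eta xi <= m%:R ^+ n.
Proof.
have := @sum_Apow R N k k2 kN n (fun=> 1) eta; rewrite iterAop_cst // mulr1 => <-.
rewrite (bigD1 xi) //= mulr1 lerDl; apply: sumr_ge0 => z _.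
by rewrite mulr1 Apow_ge0.
Qed.

(** [Apow_le] dominates the series by the exponential series of [m * t], so the limit in [heat] is a
    genuine one. *)
Lemma cvg_heat t eta xi : 0 <= t ->
  (fun M => \sum_(0 <= n < M) t ^+ n / n`!%:R * Apow R k n eta xi) @ \oo -->
  expR (m%:R * t) * heat k t eta xi.
Proof.
move=> t0; rewrite /heat mulrA expRN divff ?gt_eqF ?expR_gt0 // mul1r.
have : cvgn (series (fun n => t ^+ n / n`!%:R * Apow R k n eta xi)).
  have tn n : 0 <= t ^+ n / n`!%:R by rewrite divr_ge0 ?exprn_ge0.
  apply: (@series_le_cvg R _ (exp_coeff (m%:R * t))).
  - by move=> n; rewrite mulr_ge0 ?Apow_ge0.
  - by move=> n; apply: exp_coeff_ge0; rewrite mulr_ge0.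
  - move=> n; rewrite /exp_coeff /= exprMn.
    have -> : m%:R ^+ n * t ^+ n / n`!%:R = t ^+ n / n`!%:R * m%:R ^+ n by ring.
    by rewrite ler_wpM2l ?Apow_le.
  - exact: is_cvg_series_exp_coeff.
by [].
Qed.

Lemma cvg_expect t eta G : 0 <= t ->
  (fun M => \sum_(0 <= n < M) t ^+ n / n`!%:R * iter n Aop G eta) @ \oo -->
  expR (m%:R * t) * expect t eta G.
Proof.
move=> t0; pose u xi M := (\sum_(0 <= n < M) t ^+ n / n`!%:R * Apow R k n eta xi) * G xi.
have -> : (fun M => \sum_(0 <= n < M) t ^+ n / n`!%:R * iter n Aop G eta) =
    (fun M => \sum_xi u xi M).
  apply/funext => M; rewrite /u; under [RHS]eq_bigr do rewrite mulr_suml.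
  rewrite exchange_big /=; apply: eq_bigr => n _.
  by rewrite -(sum_Apow k2 kN) mulr_sumr; apply: eq_bigr => xi _; rewrite mulrA.
rewrite /expect mulr_sumr.
apply: cvg_big => [|xi _]; first exact: add_continuous.
rewrite mulrA; apply: cvgMl; exact: cvg_heat.
Qed.

Lemma cvg_exp_series t (C r : R) :
  (fun M => \sum_(0 <= n < M) t ^+ n / n`!%:R * (C * r ^+ n)) @ \oo --> C * expR (r * t).
Proof.
have -> : (fun M => \sum_(0 <= n < M) t ^+ n / n`!%:R * (C * r ^+ n)) =
    (fun M => C * series (exp_coeff (r * t)) M).
  apply/funext => M; rewrite /series /= mulr_sumr; apply: eq_bigr => n _.
  by rewrite /exp_coeff /= exprMn; ring.
by apply: cvgMr; exact: is_cvg_series_exp_coeff.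
Qed.

(** Termwise comparison of exponential series: a geometric bound in the number of rings becomes an
    exponential bound in time. The combination of two functions covers single expectations and
    differences alike. *)
Lemma expect_le t eta (a b : R) G G' (C r : R) : 0 <= t ->
  (forall n, a * iter n Aop G eta + b * iter n Aop G' eta <= C * r ^+ n) ->
  a * expect t eta G + b * expect t eta G' <= C * expR ((r - m%:R) * t).
Proof.
move=> t0 H.
have cl : (fun M => \sum_(0 <= n < M) t ^+ n / n`!%:R *
      (a * iter n Aop G eta + b * iter n Aop G' eta)) @ \oo -->
    expR (m%:R * t) * (a * expect t eta G + b * expect t eta G').
  have -> : expR (m%:R * t) * (a * expect t eta G + b * expect t eta G') =
    a * (expR (m%:R * t) * expect t eta G) + b * (expR (m%:R * t) * expect t eta G') by ring.
  under eq_fun => M.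
    under eq_bigr => n _ do rewrite mulrDr [_ * (a * _)]mulrCA [_ * (b * _)]mulrCA.
    rewrite big_split /= -!mulr_sumr.
    over.
  by apply: cvgD; apply: cvgMr; apply: cvg_expect.
have := ler_cvg_to cl (@cvg_exp_series t C r).
have e : expR (r * t) = expR (m%:R * t) * expR ((r - m%:R) * t).
  by rewrite -expRD; congr expR; ring.
rewrite e mulrCA ler_pM2l ?expR_gt0 //; apply.
apply: nearW => M; apply: ler_sum => n _; rewrite ler_wpM2l ?divr_ge0 ?exprn_ge0 //.
Qed.

Lemma expect_cst t eta (c : R) : 0 <= t -> expect t eta (fun=> c) = c.
Proof.
(* [expect_le] bounds from above only; the factors [1] and [-1] give both inequalities. *)
move=> t0; have le a : a * c <= a * c -> a * expect t eta (fun=> c) <= a * c.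
  move=> _; have := @expect_le t eta a 0 (fun=> c) (fun=> c) (a * c) m%:R t0.
  rewrite mul0r addr0 subrr mul0r expR0 mulr1; apply => n.
  by rewrite mul0r addr0 iterAop_cst // (_ : a * _ = a * c * m%:R ^+ n) //; ring.
have := le 1 (lexx _); have := le (-1) (lexx _); lra.
Qed.

Lemma sum_heatB t eta G : 0 <= t ->
  \sum_xi G xi * (heat k t eta xi - (N`!%:R)^-1) = expect t eta G - umean G.
Proof.
move=> t0; rewrite /expect /umean mulr_sumr -sumrB; apply: eq_bigr => xi _; ring.
Qed.

Let sum_heat0 t eta : 0 <= t -> \sum_xi (heat k t eta xi - (N`!%:R)^-1) = 0.
Proof.
move=> t0; have := sum_heatB eta (fun=> 1) t0.
rewrite expect_cst // /umean sumr_const card_Sn -[1 *+ N`!]mulr_natl mulr1 mulVf // subrr.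
by under eq_bigr do rewrite mul1r.
Qed.

(** The optimal test function is the indicator of the decks where the heat kernel exceeds the
    uniform mass. *)
Lemma dTV_le t eta (D : R) : 0 <= t ->
  (forall G, (forall xi, 0 <= G xi <= 1) -> expect t eta G - umean G <= D) -> dTV k t eta <= D.
Proof.
move=> t0 H; pose a xi := heat k t eta xi - (N`!%:R)^-1.
pose G xi : R := (0 < a xi)%R%:R.
have G01 xi : 0 <= G xi <= 1 by rewrite /G; case: (_ < _) => /=; rewrite ?lexx ?ler01.
apply: le_trans (H G G01); rewrite -sum_heatB // /dTV.
have -> : \sum_xi `|heat k t eta xi - (N`!%:R)^-1| = \sum_xi (2 * (G xi * a xi) - a xi).
  apply: eq_bigr => xi _; rewrite -/(a xi) /G; have [a0|a0] := ltP 0 (a xi) => /=.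
    by rewrite gtr0_norm //; ring.
  by rewrite ler0_norm //; ring.
by rewrite sumrB sum_heat0 // subr0 -mulr_sumr mulKf.
Qed.

(** Heat minus uniform has total mass zero, and [|1 - 2 * G| <= 1] pointwise. *)
Lemma dTV_ge t eta G : 0 <= t -> (forall xi, 0 <= G xi <= 1) ->
  umean G - expect t eta G <= dTV k t eta.
Proof.
move=> t0 G01; pose a xi := heat k t eta xi - (N`!%:R)^-1.
have : \sum_xi (a xi - 2 * (G xi * a xi)) <= \sum_xi `|a xi|.
  apply: ler_sum => xi _; have /andP[g0 g1] := G01 xi.
  have := ler_norm (a xi); have := ler_norm (- a xi); rewrite normrN; nra.
by rewrite sumrB /a sum_heat0 // -mulr_sumr sum_heatB // /dTV; lra.
Qed.

(* Comparing with the average over all starting decks, which is stationary. *)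
Lemma expect_sub_umean_le t eta G (C r : R) : 0 <= t ->
  (forall n zeta, iter n Aop G eta - iter n Aop G zeta <= C * r ^+ n) ->
  expect t eta G - umean G <= C * expR ((r - m%:R) * t).
Proof.
move=> t0 H; have := @expect_le t eta 1 (-1) G (fun=> umean G) C r t0.
rewrite expect_cst // mul1r mulN1r; apply=> n.
rewrite iterAop_cst // mul1r mulN1r /umean mulrCA -sum_iterAop.
have N0 : 0 < N`!%:R :> R by rewrite ltr0n fact_gt0.
rewrite -(ler_pM2l N0) mulrBr mulVKf //.
have -> : N`!%:R * iter n Aop G eta = \sum_(zeta : {perm 'I_N}) iter n Aop G eta.
  by rewrite sumr_const card_Sn mulr_natl.
have -> : N`!%:R * (C * r ^+ n) = \sum_(zeta : {perm 'I_N}) C * r ^+ n.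
  by rewrite sumr_const card_Sn mulr_natl.
by rewrite -sumrB; apply: ler_sum => zeta _; apply: H.
Qed.

End HeatKernel.

(** * Distance to equilibrium from above *)

Section UpperBound.
Context {R : realType}.

(** The Poincare inequality gives [A1] the Rayleigh bound [rho = m - lam] on centred functions, and
    randomising the number of rings turns [rho^n] into [exp (- lam * t)]. *)
Lemma dTV_upper N k (t : R) (eta : {perm 'I_N}) : (2 <= k)%N -> (2 * k <= N)%N ->
  (k ^ 3 <= N ^ 2)%N -> 0 <= t ->
  dTV k t eta <= 2 * N%:R ^+ 3 * expR (- (k%:R ^+ 3 / (201 * N%:R ^+ 2)) * t).
Proof.
move=> k2 kN2 k3N t0; have kN : (k <= N)%N by lia.
have N0 : 0 < N%:R :> R by rewrite ltr0n; lia.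
have k0 : 0 < k%:R :> R by rewrite ltr0n; lia.
pose lam : R := k%:R ^+ 3 / (201 * N%:R ^+ 2).
have D0 : 0 < 201 * N%:R ^+ 2 :> R by rewrite mulr_gt0 ?exprn_gt0.
have lam1 : lam < 1.
  rewrite ltr_pdivrMr // mul1r.
  have : k%:R ^+ 3 <= N%:R ^+ 2 :> R by rewrite -!natrX ler_nat.
  have : 0 < N%:R ^+ 2 :> R by rewrite exprn_gt0.
  lra.
have m1 : 1 <= (nblocks N k)%:R :> R by rewrite ler1n nblocks_gt0.
pose rho : R := (nblocks N k)%:R - lam.
have rho0 : 0 < rho by rewrite /rho; lra.
have gap (f : nat -> R) : \sum_(x < N) f x = 0 -> ip N f (A1 N k f) <= rho * ip N f f.
  move=> f0; rewrite ip_sym (ip_A1E (ltnW k2) kN) /rho mulrBl lerD2l lerN2.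
  have -> : lam * ip N f f = k%:R ^+ 3 * ip N f f / (201 * N%:R ^+ 2) by rewrite /lam; ring.
  rewrite ler_pdivrMr // [leRHS]mulrC; exact: spectral_gap.
apply: dTV_le => // G G01; have -> : - lam = rho - (nblocks N k)%:R by rewrite /rho; ring.
apply: expect_sub_umean_le => // n zeta.
exact: (iterAop_diff_le k2 kN rho0 gap).
Qed.

End UpperBound.

(** * Distance to equilibrium from below *)

Section LowerBound.
Context {R : realType}.

(** The two constants of [bcov_bound] times the square of the factor [2 pi^2] in the Laplacian
    bound. *)
Definition regularity_const : R := (64 ^+ 2 + 128 * 256 ^+ 2) * (4 * pi ^+ 4).

Lemma regularity_const_ge0 : 0 <= regularity_const.
Proof.
have p4 : 0 <= pi ^+ 4 :> R by rewrite exprn_ge0 ?pi_ge0.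
rewrite /regularity_const; lra.
Qed.

Context (N k : nat) (k2 : (2 <= k)%N) (kN11 : (11 * k <= N)%N) (k3N : (k ^ 3 <= N ^ 2)%N).
Local Notation m := (nblocks N k).
Local Notation A1 := (@A1 R N k).
Local Notation phi := (@cprof R N).
Local Notation lam := (@crate R N k).
Local Notation Psi := regularity_const.

Let N2 : (2 <= N)%N. Proof. lia. Qed.
Let kN : (k <= N)%N. Proof. lia. Qed.
Let k0 : (0 < k)%N. Proof. lia. Qed.
Let N0 : 0 < N%:R :> R. Proof. by rewrite ltr0n; lia. Qed.
Let kR : 0 < k%:R :> R. Proof. by rewrite ltr0n; lia. Qed.
Let m1 : 1 <= m%:R :> R. Proof. by rewrite ler1n nblocks_gt0. Qed.

(** [m - A1] commutes with [A1], and each application of [A1] multiplies an upper bound by [m]. *)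
Let iter_laplacian_le n x : (x < N)%N ->
  m%:R * iter n A1 phi x - A1 (iter n A1 phi) x <=
  m%:R ^+ n * (2 * (pi / N%:R) ^+ 2 * k%:R ^+ 3).
Proof.
move=> xN; have := @iterA1_le_sup R N k k0 kN n (fun x => m%:R * phi x + (-1) * A1 phi x)
  (2 * (pi / N%:R) ^+ 2 * k%:R ^+ 3).
rewrite iterA1_lin -iterSr iterS => h.
have := h _ _ xN; rewrite mulN1r; apply=> y yN; rewrite mulN1r.
exact: cprof_laplacian_le.
Qed.

(** With [q = k^3 / N^2] the Laplacian bound is [2 pi^2 q m^n]; the factor [N^2 / k^3] of
    [bcov_bound] cancels one of the two powers of [q], and [q <= 1] disposes of the rest. *)
Lemma bcov_iter_cprof_le n i : (i < m)%N ->
  bcov k i (iter n A1 phi) (iter n A1 phi) <= Psi * m%:R ^+ (2 * n).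
Proof.
move=> im; set e : R := m%:R ^+ n * (2 * (pi / N%:R) ^+ 2 * k%:R ^+ 3).
have mn0 : 0 <= m%:R ^+ n :> R by rewrite exprn_ge0.
have e0 : 0 <= e.
  by rewrite mulr_ge0 // mulr_ge0 ?exprn_ge0 // mulr_ge0 ?sqr_ge0.
have dec : decr N (iter n A1 phi) by apply: decr_iterA1 => //; exact: cprof_decr.
have ant : antisym N (iter n A1 phi) by apply: antisym_iterA1 => //; exact: cprof_antisym.
apply: (le_trans (bcov_bound k2 kN dec ant e0 kN11 im (@iter_laplacian_le n))).
have k3N' : k%:R ^+ 3 <= N%:R ^+ 2 :> R by rewrite -!natrX ler_nat.
set q : R := k%:R ^+ 3 / N%:R ^+ 2.
have q0 : 0 <= q by rewrite divr_ge0 ?exprn_ge0.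
have q1 : q <= 1 by rewrite ler_pdivrMr ?exprn_gt0 // mul1r.
have -> : e = 2 * pi ^+ 2 * q * m%:R ^+ n by rewrite /e /q; field; rewrite lt0r_neq0.
have -> : 128 * 256 ^+ 2 * (2 * pi ^+ 2 * q * m%:R ^+ n) ^+ 2 * N%:R ^+ 2 / k%:R ^+ 3 =
    128 * 256 ^+ 2 * (4 * pi ^+ 4) * q * (m%:R ^+ n) ^+ 2.
  by rewrite /q; field; rewrite !lt0r_neq0.
have -> : m%:R ^+ (2 * n) = (m%:R ^+ n) ^+ 2 :> R by rewrite mulnC exprM.
have -> : 64 ^+ 2 * (2 * pi ^+ 2 * q * m%:R ^+ n) ^+ 2 =
   64 ^+ 2 * (4 * pi ^+ 4) * (q ^+ 2) * (m%:R ^+ n) ^+ 2 by ring.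
rewrite /regularity_const.
have p4 : 0 <= 4 * pi ^+ 4 :> R by rewrite mulr_ge0 ?exprn_ge0 ?pi_ge0.
have M2 := sqr_ge0 (m%:R ^+ n : R).
have h1 : (4 * pi ^+ 4) * q * (m%:R ^+ n) ^+ 2 <= (4 * pi ^+ 4) * (m%:R ^+ n) ^+ 2.
  by rewrite ler_wpM2r // ler_piMr.
have h2 : (4 * pi ^+ 4) * q ^+ 2 * (m%:R ^+ n) ^+ 2 <= (4 * pi ^+ 4) * (m%:R ^+ n) ^+ 2.
  by rewrite ler_wpM2r // ler_piMr // exprn_ile1.
lra.
Qed.

Let pullback1 : pullback phi (1%g : {perm 'I_N}) = phi.
Proof.
apply/funext => y; rewrite /pullback /perm_nat; case: insubP => // x _ <-.
by rewrite perm1.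
Qed.

Let lower_mean n : lam < 1 ->
  (m%:R - lam) ^+ n * (N%:R / 2) <= ip N phi (iter n A1 phi) :> R.
Proof.
move=> lam1; have r0 : 0 <= m%:R - lam by move: m1; lra.
rewrite -(ip_cprof N2); apply: ip_iterA1_lower => //.
rewrite ip_sym ip_A1E // mulrBl lerD2l lerN2.
exact: sum_bcov_cprof_le.
Qed.

(** The test event is [F < tau]. Chebyshev makes it likely under the uniform law. From the sorted
    deck, its weight after [n] rings is bounded by a multiple of [(m^3 / rho^2)^n], valid for every
    [n], so that [expect_le] can sum it. *)
Lemma dTV_lower (t tau : R) : lam < 1 -> 0 <= t -> 0 < tau ->
  1 - N%:R / tau ^+ 2 - 16 * ((Psi / 2 + 1) * N%:R + tau ^+ 2) / N%:R ^+ 2 *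
    expR ((m%:R ^+ 3 / (m%:R - lam) ^+ 2 - m%:R) * t) <= dTV k t (1%g : {perm 'I_N}).
Proof.
move=> lam1 t0 tau0; pose F := @linstat R N phi phi; set rho : R := m%:R - lam.
have rho0 : 0 < rho by move: m1; rewrite /rho; lra.
pose G (xi : {perm 'I_N}) : R := (F xi < tau)%R%:R.
have G01 xi : 0 <= G xi <= 1 by rewrite /G; case: (_ < _) => /=; rewrite ?lexx ?ler01.
set K : R := (Psi / 2 + 1) * N%:R + tau ^+ 2.
have K0 : 0 <= K.
  by rewrite addr_ge0 ?sqr_ge0 // mulr_ge0 // addr_ge0 // divr_ge0 ?regularity_const_ge0.
apply: le_trans (dTV_ge k2 kN (1%g : {perm 'I_N}) t0 G01); apply: lerB.
  have N0f : 0 < N`!%:R :> R by rewrite ltr0n fact_gt0.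
  have H := @avg_sqr_linstat_perm R N phi phi N2 (@sqr_cprof_le1 R N).
  have phi0 : \sum_(x < N) phi x = 0 :> R.
    have e : \sum_(x < N) phi x = - \sum_(x < N) phi x :> R.
      rewrite {1}(reindex_inj rev_ord_inj) /= -sumrN; apply: eq_bigr => x _.
      rewrite (_ : (N - x.+1 = N.-1 - x)%N); last by lia.
      exact: (@cprof_antisym R N N2).
    by lra.
  have {}H := H phi0; rewrite ip_cprof // in H.
  have tau2 : 0 < tau ^+ 2 by rewrite exprn_gt0.
  have step : \sum_xi (1 - G xi) <= \sum_xi F xi ^+ 2 / tau ^+ 2.
    apply: ler_sum => xi _; rewrite /G; have [Ft|tF] := ltP (F xi) tau => /=.
      by rewrite subrr divr_ge0 ?sqr_ge0.
    rewrite subr0 ler_pdivlMr // mul1r ler_sqr ?nnegrE //; first exact: ltW.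
    exact: le_trans (ltW tau0) tF.
  rewrite /umean; move: step H; rewrite sumrB -mulr_suml sumr_const card_Sn.
  rewrite -[1 *+ N`!]mulr_natl mulr1.
  rewrite -/F; set S1 := \sum_xi G xi; set S2 := \sum_xi F xi ^+ 2 => step H.
  have : (N`!%:R)^-1 * (N`!%:R - S1) <= (N`!%:R)^-1 * (S2 / tau ^+ 2).
    by rewrite ler_wpM2l ?invr_ge0 // ltW.
  rewrite mulrBr mulVf ?gt_eqF //.
  have : (N`!%:R)^-1 * S2 / tau ^+ 2 <= 2 * (N%:R / 2) / tau ^+ 2.
    by rewrite ler_pM2r ?invr_gt0.
  by rewrite mulrA; lra.
have := @expect_le R N k k2 kN t 1%g 1 0 G G (16 * K / N%:R ^+ 2) (m%:R ^+ 3 / rho ^+ 2) t0.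
rewrite mul0r addr0 mul1r; apply=> n; rewrite mul0r addr0 mul1r.
set c : R := ip N phi (iter n A1 phi); set M : R := m%:R ^+ n.
have M0 : 0 < M by rewrite exprn_gt0 //; move: m1; lra.
have c_ge : rho ^+ n * (N%:R / 2) <= c by exact: lower_mean lam1.
have r0 : 0 < rho ^+ n by rewrite exprn_gt0.
have c0 : 0 < c by apply: lt_le_trans c_ge; rewrite mulr_gt0 ?divr_gt0.
have meanF : iter n (@Aop R N k) F 1%g = c by rewrite iterAop_linstat // /linstat pullback1.
have sqF : M * iter n (@Aop R N k) (fun xi => F xi ^+ 2) 1%g <=
    c ^+ 2 + (Psi / 2 + 1) * N%:R * M ^+ 2.
  have h1 := @iterAop_sqr_linstat R N k k2 kN n phi phi 1%g (@sqr_cprof_le1 R N).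
  have h2 := @word_energy_le R N k k2 kN Psi phi n phi bcov_iter_cprof_le.
  rewrite pullback1 ip_cprof // -/M in h1.
  rewrite ip_cprof // -/M -/c (_ : m%:R ^+ (2 * n) = M ^+ 2) in h2; last by rewrite mulnC exprM.
  have := ler_wpM2l (ltW M0) h1; rewrite -/F; lra.
pose mu := c / M.
have mu0 : 0 < mu by rewrite divr_gt0.
(* [mu] is the mean of [F] after [n] rings. If [tau <= mu / 2], then [F < tau] forces a deviation of
   at least [mu / 2]; otherwise [4 tau^2 / mu^2] alone exceeds [1]. The bound is written as a linear
   combination of [F^2], [F] and a constant to fit [iterAop_lin]. *)
have GF xi : G xi <= 4 / mu ^+ 2 * F xi ^+ 2 +
   1 * ((- (8 / mu)) * F xi + 1 * (4 / mu ^+ 2 * (mu ^+ 2 + tau ^+ 2))).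
  have -> : 4 / mu ^+ 2 * F xi ^+ 2 +
   1 * ((- (8 / mu)) * F xi + 1 * (4 / mu ^+ 2 * (mu ^+ 2 + tau ^+ 2))) =
   4 * ((F xi - mu) ^+ 2 + tau ^+ 2) / mu ^+ 2 by field; rewrite lt0r_neq0.
  have B0 : 0 <= 4 * ((F xi - mu) ^+ 2 + tau ^+ 2) by rewrite mulr_ge0 ?addr_ge0 ?sqr_ge0.
  rewrite /G; case: ltP => /= [Ft|_]; last by rewrite divr_ge0 ?sqr_ge0.
  rewrite ler_pdivlMr ?exprn_gt0 // mul1r.
  have := sqr_ge0 (F xi - mu).
  have [tm|tm] := leP tau (mu / 2); nra.
have it := @iterAop_le R N k n G _ GF 1%g.
apply: (le_trans it); rewrite !iterAop_lin // !iterAop_cst // -/M meanF.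
set X := iter n _ _ _ in sqF *.
apply: (@le_trans _ _ (4 * M ^+ 3 * K / c ^+ 2)).
  have -> : 4 / mu ^+ 2 * X + 1 * (- (8 / mu) * c + 1 * (M * (4 / mu ^+ 2 * (mu ^+ 2 + tau ^+ 2))))
    = 4 * M * (M * X - c ^+ 2 + M ^+ 2 * tau ^+ 2) / c ^+ 2.
    by rewrite /mu; field; rewrite !lt0r_neq0.
  rewrite ler_pM2r ?invr_gt0 ?exprn_gt0 //.
  have -> : 4 * M ^+ 3 * K = 4 * M * (M ^+ 2 * K) by ring.
  rewrite ler_pM2l ?mulr_gt0 // /K; lra.
have -> : (m%:R ^+ 3 / rho ^+ 2) ^+ n = M ^+ 3 / (rho ^+ n) ^+ 2.
  by rewrite expr_div_n /M -!exprM [(3 * n)%N]mulnC [(2 * n)%N]mulnC.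
have -> : 16 * K / N%:R ^+ 2 * (M ^+ 3 / (rho ^+ n) ^+ 2) =
   4 * M ^+ 3 * K / (rho ^+ n * (N%:R / 2)) ^+ 2 by field; rewrite !lt0r_neq0.
rewrite ler_wpM2l ?mulr_ge0 ?exprn_ge0 ?(ltW M0) // lef_pV2 ?posrE ?exprn_gt0 ?mulr_gt0 ?divr_gt0 //.
by rewrite ler_sqr ?nnegrE ?mulr_ge0 ?divr_ge0 // ltW.
Qed.

End LowerBound.

(** * Asymptotics of the mixing time *)

Section Asymptotics.
Context {R : realType}.

Lemma limn_esup_le_eventually (u : (\bar R)^nat) (c : \bar R) n0 :
  (forall n, (n0 <= n)%N -> (u n <= c)%E) -> (limn_esup u <= c)%E.
Proof.
move=> H; rewrite /limn_esup /limf_esup; apply: ge_ereal_inf.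
exists (ereal_sup [set u x | x in [set n | (n0 <= n)%N]]).
  by exists [set n | (n0 <= n)%N] => //; exact: nbhs_infty_ge.
by apply: ge_ereal_sup => _ [n /= n0n <-]; exact: H.
Qed.

Lemma limn_einf_ge_eventually (u : (\bar R)^nat) (c : \bar R) n0 :
  (forall n, (n0 <= n)%N -> (c <= u n)%E) -> (c <= limn_einf u)%E.
Proof.
move=> H; rewrite -leeN2 -limn_esupN; apply: (@limn_esup_le_eventually _ _ n0) => n n0n.
by rewrite /= leeN2; exact: H.
Qed.

Lemma eventually_ge (C : R) : exists n0, forall n, (n0 <= n)%N -> C <= n%:R.
Proof.
exists (Num.bound `|C|) => n n0; apply: (le_trans (ler_norm C)).
by apply: (le_trans (ltW (archi_boundP (normr_ge0 C)))); rewrite ler_nat.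
Qed.

Lemma eventually_small_exp_ln (a C e : R) : 0 < a -> 0 < e ->
  exists n0, forall n, (n0 <= n)%N -> C * expR (- (a * ln n%:R)) <= e.
Proof.
move=> a0 e0; have [n0 H] := eventually_ge (expR (a^-1 * ln (`|C| / e + 1))).
exists n0.+1 => n n0n; have {}H := H n (ltnW n0n).
have nR : 0 < n%:R :> R by rewrite ltr0n; lia.
have q0 : 0 <= `|C| / e by rewrite divr_ge0 // ltW.
have L : ln (`|C| / e + 1) <= a * ln n%:R.
  by rewrite -ler_pdivrMl // -[leLHS]expRK ler_ln ?posrE ?expR_gt0.
have {}L : `|C| / e + 1 <= expR (a * ln n%:R).
  by rewrite -[leLHS]lnK ?posrE ?ler_expR //; lra.
apply: (@le_trans _ _ (`|C| * expR (- (a * ln n%:R)))).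
  by rewrite ler_wpM2r ?expR_ge0 ?ler_norm.
rewrite expRN ler_pdivrMr ?expR_gt0 // -ler_pdivrMl // mulrC; lra.
Qed.

Lemma littleo_cube (k : nat -> nat) (d : R) : 0 < d -> d <= 1 ->
  (fun N : nat => (k N)%:R : R) =o_\oo (fun N : nat => (N%:R : R) `^ (2 / 3)) ->
  exists n0, forall N, (n0 <= N)%N -> (k N)%:R ^+ 3 <= d * N%:R ^+ 2 :> R.
Proof.
move=> d0 d1 /eqoP /(_ d d0) [n0 _ H]; exists n0 => N n0N.
have := H N n0N; rewrite /= normr_nat ger0_norm ?powR_ge0 // => h.
have h3 : (k N)%:R ^+ 3 <= (d * N%:R `^ (2 / 3)) ^+ 3.
  by rewrite lerXn2r ?nnegrE ?mulr_ge0 ?powR_ge0 ?(ltW d0).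
apply: (le_trans h3); rewrite exprMn.
have -> : (N%:R `^ (2 / 3)) ^+ 3 = N%:R ^+ 2 :> R.
  rewrite -powR_mulrn ?powR_ge0 // -powRrM -powR_mulrn ?ler0n //.
  by congr (_ `^ _); field.
rewrite ler_wpM2r ?exprn_ge0 // exprS -[leRHS]mulr1 ler_wpM2l ?(ltW d0) //.
by rewrite exprn_ile1 // ltW.
Qed.

(** If [11 * k > N], then [N^3 < 1331 k^3 <= 1331 N^2], and [1331 = 11^3]. *)
Lemma cube_bound_linear (k N : nat) : (1331 <= N)%N ->
  k%:R ^+ 3 <= N%:R ^+ 2 :> R -> (11 * k <= N)%N.
Proof.
rewrite -!natrX ler_nat => N1 kN; rewrite leqNgt; apply/negP => h; nia.
Qed.

Lemma mix_ratio_upper (k : nat -> nat) (eps : R) (N : nat) : (2 <= k N)%N ->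
  (3 <= N)%N -> (11 * k N <= N)%N -> (k N ^ 3 <= N ^ 2)%N ->
  2 * expR (- (1 * ln N%:R)) <= eps / 2 -> 0 < eps ->
  (mix_ratio k eps N <= 804%:E)%E.
Proof.
move=> k2 N3 kN11 k3N small eps0; rewrite /mix_ratio; set K := k N in k2 kN11 k3N *.
have N0 : 0 < N%:R :> R by rewrite ltr0n; lia.
have k0 : 0 < K%:R :> R by rewrite ltr0n; lia.
have lnN : 0 < ln N%:R :> R by rewrite ln_gt0 // ltr1n; lia.
(* [804 = 4 * 201] makes the exponential in [dTV_upper] equal to [N^-4], which beats the prefactor
   [2 N^3]. *)
pose T : R := 804 * (N%:R ^+ 2 * ln N%:R) / K%:R ^+ 3.
have T0 : 0 <= T.
  apply: divr_ge0; last by rewrite exprn_ge0 // ltW.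
  apply: mulr_ge0; first exact: ler0n.
  by apply: mulr_ge0; [exact: sqr_ge0 | exact: ltW].
have tT : (tmix N K eps <= T%:E)%E.
  apply: ereal_inf_lbound; exists T => //; split => // eta.
  apply: (le_lt_trans (dTV_upper eta k2 _ k3N T0)); first by lia.
  have -> : - (K%:R ^+ 3 / (201 * N%:R ^+ 2)) * T = - (4%:R * ln N%:R).
    by rewrite /T; field; rewrite !lt0r_neq0.
  have -> : expR (- (4%:R * ln N%:R)) = (N%:R ^+ 4)^-1 :> R.
    by rewrite expRN expRM_natl lnK.
  move: small; rewrite mul1r expRN lnK ?posrE // => small.
  have -> : 2 * N%:R ^+ 3 * (N%:R ^+ 4)^-1 = 2 * N%:R^-1 :> R by field; rewrite lt0r_neq0.
  by apply: (le_lt_trans small); lra.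
have ck0 : (0 <= ((K * (K ^ 2 - 1))%N%:R : R)%:E)%E by rewrite lee_fin.
have cN0 : (0 <= ((N%:R ^+ 2 * ln N%:R)^-1 : R)%:E)%E.
  by rewrite lee_fin invr_ge0 mulr_ge0 ?exprn_ge0 // ltW.
apply: (le_trans (lee_wpmul2r cN0 (lee_wpmul2l ck0 tT))).
rewrite -!EFinM lee_fin.
have kk : (K * (K ^ 2 - 1))%N%:R <= K%:R ^+ 3 :> R.
  by rewrite -natrX ler_nat expnS leq_mul2l leq_subr orbT.
have -> : (K * (K ^ 2 - 1))%N%:R * T / (N%:R ^+ 2 * ln N%:R) =
   804 * ((K * (K ^ 2 - 1))%N%:R / K%:R ^+ 3) by rewrite /T; field; rewrite !lt0r_neq0.
apply: ler_piMr; first exact: ler0n.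
by rewrite ler_pdivrMr ?mul1r // exprn_gt0.
Qed.

Lemma mix_ratio_lower (k : nat -> nat) (eps d : R) (N : nat) : (2 <= k N)%N ->
  (3 <= N)%N -> (11 * k N <= N)%N -> 0 < d -> d < 1 ->
  (k N)%:R ^+ 3 <= d / 16 * N%:R ^+ 2 :> R -> eps < 1 ->
  (1 + 16 * (regularity_const / 2 + 2)) * expR (- (d ^+ 2 / 2 * ln N%:R)) <= 1 - eps ->
  ((6 / pi ^+ 2 * (1 - d))%:E <= mix_ratio k eps N)%E.
Proof.
move=> k2 N3 kN11 d0 d1 k3N eps1 small; rewrite /mix_ratio; set K := k N in k2 kN11 k3N *.
have N0 : 0 < N%:R :> R by rewrite ltr0n; lia.
have k0 : 0 < K%:R :> R by rewrite ltr0n; lia.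
have kN : (K <= N)%N by lia.
set n := ln N%:R in small *.
have n0 : 0 < n by rewrite ln_gt0 // ltr1n; lia.
have pi0 : 0 < pi :> R := pi_gt0 R.
have N20 : 0 < N%:R ^+ 2 :> R by rewrite exprn_gt0.
have k3N' : (K ^ 3 <= N ^ 2)%N.
  rewrite -(ler_nat R) !natrX; apply: (le_trans k3N); nra.
set ck := (K * (K ^ 2 - 1))%N%:R.
have ckE : ck = K%:R * (K%:R ^+ 2 - 1) :> R.
  have K1 : (1 <= K ^ 2)%N by rewrite expn_gt0 (ltnW k2).
  by rewrite /ck natrM (natrB _ K1) natrX.
have k4 : 4 <= K%:R ^+ 2 :> R by rewrite -natrX ler_nat (leq_exp2r 2 _ (ltn0Sn 1)).
have ck0 : 0 < ck :> R by rewrite ckE mulr_gt0 //; lra.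
set lam : R := @crate R N K.
have lamE : lam = pi ^+ 2 * ck / (12 * N%:R ^+ 2) by rewrite /lam /crate ckE.
have lam0 : 0 < lam by rewrite lamE divr_gt0 ?mulr_gt0 ?exprn_gt0.
have pi4 : pi ^+ 2 <= 16 :> R.
  have [/andP[_ p2] _] := pihalf_02_cos_pihalf R.
  have p4 : pi <= 4 :> R by lra.
  by nra.
have lamd : lam <= d / 8.
  rewrite lamE ler_pdivrMr ?mulr_gt0 //.
  have ck3 : ck <= K%:R ^+ 3 by rewrite ckE; nra.
  have := ler_pM (sqr_ge0 pi) (ltW ck0) pi4 ck3; nra.
(* The second moment bound decays at rate about [2 * lam], and it must lose slightly less than one
   power of [N]. *)
pose T : R := (1 - d) * n / (2 * lam).
have d1' : 0 < 1 - d by rewrite subr_gt0.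
have T0 : 0 < T by apply: divr_gt0; apply: mulr_gt0.
have tT : (T%:E <= tmix N K eps)%E.
  apply/ereal_infP => _ [t [t0 H] <-]; rewrite lee_fin leNgt; apply/negP => tT.
  have := H 1%g; apply/negP; rewrite -leNgt.
  (* With [tau^2 = N^(1 + d/2)], the uniform error is [N^(-d/2)] and the other prefactor is of order
     [N^(-(1 - d/2))]. The time factor is at most [N^((1 + d/2)(1 - d))], which leaves [N^(-d^2/2)];
     both errors are thus controlled by [E]. *)
  pose tau := expR ((1 + d / 2) * n / 2).
  have tau0 : 0 < tau by exact: expR_gt0.
  have lam1 : lam < 1 by lra.
  apply: le_trans (dTV_lower k2 kN11 k3N' lam1 t0 tau0).
  have NE : N%:R = expR n by rewrite lnK.
  have tau2 : tau ^+ 2 = expR ((1 + d / 2) * n).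
    by rewrite /tau -expRM_natl; congr expR; field.
  have := nblocks_gt0 kN; rewrite -(ler1n R); set m : R := (nblocks N K)%:R => m1.
  set Psi := @regularity_const R in small *.
  have Psi0 : 0 <= Psi := @regularity_const_ge0 R.
  set E := expR (- (d ^+ 2 / 2 * n)) in small.
  have dn : 0 <= d * (1 - d) * n by rewrite ltW // mulr_gt0 // mulr_gt0.
  have b1 : N%:R / tau ^+ 2 <= E.
    rewrite NE tau2 -expRN -expRD ler_expR; lra.
  have b2 : ((Psi / 2 + 1) * N%:R + tau ^+ 2) / N%:R ^+ 2 <= (Psi / 2 + 2) * expR (- ((1 - d / 2) * n)).
    have e2 : expR (- ((1 - d / 2) * n)) * N%:R ^+ 2 = expR ((1 + d / 2) * n).
      by rewrite NE -expRM_natl -expRD; congr expR; ring.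
    rewrite ler_pdivrMr // -[leRHS]mulrA e2 NE.
    have d2n : 0 < d * n by exact: mulr_gt0.
    have le_e : expR n <= expR ((1 + d / 2) * n) by rewrite ler_expR; lra.
    have P1 : 0 <= Psi / 2 + 1 by lra.
    by have := ler_wpM2l P1 le_e; rewrite tau2; lra.
  have b3 : (m ^+ 3 / (m - lam) ^+ 2 - m) * t <= (1 + d / 2) * (1 - d) * n.
    have ml : 0 < (m - lam) ^+ 2 by rewrite exprn_gt0 //; lra.
    (* To first order in [lam / m] the left side is [2 * lam]; [lam <= d / 8] and [m >= 1] keep the
       correction within the factor [1 + d / 2]. *)
    have r1 : m ^+ 3 / (m - lam) ^+ 2 - m <= 2 * lam * (1 + d / 2).
      rewrite lerBlDr ler_pdivrMr //.
      have q1 : 5 * lam * (m * lam) <= d * m * (m * lam).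
        by apply: ler_wpM2r; [rewrite mulr_ge0 //; lra | nra].
      have q2 : 0 <= (1 - d) * (m * lam ^+ 2).
        apply: mulr_ge0; first exact: ltW.
        by apply: mulr_ge0; [lra | exact: sqr_ge0].
      have q3 : 0 <= (2 + d) * lam ^+ 3 by rewrite mulr_ge0 ?exprn_ge0 ?(ltW lam0) //; lra.
      lra.
    apply: (@le_trans _ _ (2 * lam * (1 + d / 2) * t)); first by rewrite ler_wpM2r.
    have -> : (1 + d / 2) * (1 - d) * n = 2 * lam * (1 + d / 2) * T.
      by rewrite /T; field; rewrite lt0r_neq0.
    apply: ler_wpM2l (ltW tT); apply: mulr_ge0; last by lra.
    by apply: mulr_ge0; [exact: ler0n | exact: ltW].
  have b4 : expR (- ((1 - d / 2) * n)) * expR ((m ^+ 3 / (m - lam) ^+ 2 - m) * t) <= E.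
    by rewrite -expRD ler_expR; lra.
  have b5 : ((Psi / 2 + 1) * N%:R + tau ^+ 2) / N%:R ^+ 2 *
      expR ((m ^+ 3 / (m - lam) ^+ 2 - m) * t) <= (Psi / 2 + 2) * E.
    apply: (le_trans (ler_wpM2r (expR_ge0 _) b2)); rewrite -mulrA.
    by rewrite ler_wpM2l //; lra.
  rewrite -!(mulrA 16); lra.
have ck0' : (0 <= ((K * (K ^ 2 - 1))%N%:R : R)%:E)%E by rewrite lee_fin.
have cN0 : (0 <= ((N%:R ^+ 2 * n)^-1 : R)%:E)%E.
  by rewrite lee_fin invr_ge0 mulr_ge0 ?exprn_ge0 // ltW.
apply: (le_trans _ (lee_wpmul2r cN0 (lee_wpmul2l ck0' tT))).
rewrite -!EFinM lee_fin -/ck le_eqVlt; apply/orP; left; apply/eqP.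
(* At time [T] the ratio is exactly [6 / pi^2 * (1 - d)], since [lam] carries the same factor
   [k (k^2 - 1) / N^2]. *)
rewrite /T lamE; have fieldE (p c q l : R) : 0 < p -> 0 < c -> 0 < q -> 0 < l ->
    6 / p * (1 - d) = c * ((1 - d) * l / (2 * (p * c / (12 * q)))) / (q * l).
  by move=> *; field; rewrite !lt0r_neq0.
by apply: fieldE => //; exact: exprn_gt0.
Qed.

End Asymptotics.

Theorem theorem1p1 (R : realType) :
  exists c : R, 0 < c /\
  forall k : nat -> nat,
    (forall N, (2 <= k N)%N) ->
    (fun N : nat => (k N)%:R : R) =o_\oo (fun N : nat => (N%:R : R) `^ (2 / 3)) ->
    forall eps : R, 0 < eps < 1 ->
      [/\ ((6 / pi ^+ 2)%:E <= limn_einf (mix_ratio k eps))%E,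
          (limn_einf (mix_ratio k eps) <= limn_esup (mix_ratio k eps))%E &
          (limn_esup (mix_ratio k eps) <= c%:E)%E].
Proof.
exists 804; split; first by rewrite ltr0n.
move=> k k2 ko eps /andP[eps0 eps1]; split; last 1 first.
- have [n1 H1] := littleo_cube ltr01 (lexx 1) ko.
  have e20 : 0 < eps / 2 by rewrite divr_gt0.
  have [n2 H2] := eventually_small_exp_ln 2 ltr01 e20.
  apply: (@limn_esup_le_eventually _ _ _ (n1 + n2 + 1331)) => N nN.
  have k3 : (k N)%:R ^+ 3 <= N%:R ^+ 2 :> R by rewrite -[leRHS]mul1r; apply: H1; lia.
  apply: mix_ratio_upper => //; first lia.
  + by apply: cube_bound_linear k3; lia.
  + by rewrite -(ler_nat R) !natrX.
  + by apply: H2; lia.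
- apply/lee_subgt0Pr => e e0; set a : R := 6 / pi ^+ 2.
  have a0 : 0 < a by rewrite divr_gt0 ?exprn_gt0 ?pi_gt0.
  (* This [d] lies in [(0, 1)] and satisfies [a * d <= e]. *)
  pose d := e / (a + e); have ae0 : 0 < a + e by exact: addr_gt0.
  have d0 : 0 < d by rewrite divr_gt0.
  have d1 : d < 1 by rewrite ltr_pdivrMr // mul1r ltrDr.
  have ad : a - e <= a * (1 - d).
    have -> : a * (1 - d) = a - e * (a / (a + e)) by rewrite /d; field; rewrite lt0r_neq0.
    rewrite lerD2l lerN2 ler_piMr ?(ltW e0) // ler_pdivrMr // mul1r lerDl; exact: ltW.
  have d160 : 0 < d / 16 by rewrite divr_gt0.
  have d161 : d / 16 <= 1 by lra.
  have [n1 H1] := littleo_cube d160 d161 ko.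
  have eps1' : 0 < 1 - eps by rewrite subr_gt0.
  have d20 : 0 < d ^+ 2 / 2 by rewrite divr_gt0 ?exprn_gt0.
  have [n2 H2] := eventually_small_exp_ln (1 + 16 * (regularity_const / 2 + 2)) d20 eps1'.
  apply: (@limn_einf_ge_eventually _ _ _ (n1 + n2 + 1331)) => N nN.
  have n1N : (n1 <= N)%N by apply: leq_trans nN; rewrite -addnA leq_addr.
  have n2N : (n2 <= N)%N by apply: leq_trans nN; rewrite addnAC leq_addl.
  have N1331 : (1331 <= N)%N by apply: leq_trans nN; rewrite leq_addl.
  have k3 := H1 N n1N.
  apply: (@le_trans _ _ (a * (1 - d))%:E); first by rewrite -EFinB lee_fin.
  apply: (mix_ratio_lower (k2 N) _ _ d0 d1 k3 eps1 (H2 N n2N)).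
    exact: leq_trans N1331.
  apply: (cube_bound_linear N1331); apply: (le_trans k3).
  by apply: ler_piMl d161; exact: sqr_ge0.
- exact: limn_einf_sup.
Qed.
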